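(* Suppose $n>1$ and let $k\in\mathbb{N}$. Then $\mathcal{H}_k$ is an irreducible $osp(2n|2m)$-module if and only if $k\leq m+1-n$ or $k>2(m+1-n)$. When $k\leq m+1-n$, $\mathcal{A}_k=\bigoplus_{i=0}^{\lfloor k/2\rfloor}\eta^i\mathcal{H}_{k-2i}$ is a decomposition of $\mathcal{A}_k$ into irreducible $osp(2n|2m)$-submodules.
   Context: Fix positive integers $n,m$. Let $\mathcal{A}$ be the complex supercommutative polynomial algebra in even variables $x_1,\dots,x_n,y_1,\dots,y_n$ and odd (mutually anticommuting) variables $\theta_1,\dots,\theta_m,\vartheta_1,\dots,\vartheta_m$, with usual partial derivatives $\partial_{x_i},\partial_{y_i}$ and odd derivations $\partial_{\theta_r},\partial_{\vartheta_r}$ (for odd $\tau$: $\partial_\tau(\tau')=\delta_{\tau,\tau'}$ on odd variables, kills even variables, $\partial_\tau(fg)=\partial_\tau(f)g+(-1)^\iota f\partial_\tau(g)$ for $f$ of parity $\iota$). In $gl(2n|2m)$ (matrix units $E_{a,b}$, $a,b\in\{1,\dots,2n+2m\}$, indices $\le 2n$ even, the others odd), $osp(2n|2m)$ is the subsuperalgebra spanned by the following elements, which act on $\mathcal{A}$ by the indicated operators ($i,j\in\{1,..,n\}$, $r,s\in\{1,..,m\}$): $E_{i,j}-E_{n+j,n+i}\mapsto x_i\partial_{x_j}-y_j\partial_{y_i}$; $E_{2n+r,2n+s}-E_{2n+m+s,2n+m+r}\mapsto\theta_r\partial_{\theta_s}-\vartheta_s\partial_{\vartheta_r}$; $E_{i,2n+r}-E_{2n+m+r,n+i}\mapsto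 x_i\partial_{\theta_r}-\vartheta_r\partial_{y_i}$; $E_{2n+r,i}+E_{n+i,2n+m+r}\mapsto\theta_r\partial_{x_i}+y_i\partial_{\vartheta_r}$; for $i<j$: $E_{i,n+j}-E_{j,n+i}\mapsto x_i\partial_{y_j}-x_j\partial_{y_i}$ and $E_{n+i,j}-E_{n+j,i}\mapsto y_i\partial_{x_j}-y_j\partial_{x_i}$; for $r\le s$: $E_{2n+m+r,2n+s}+E_{2n+m+s,2n+r}\mapsto\vartheta_r\partial_{\theta_s}+\vartheta_s\partial_{\theta_r}$ and $E_{2n+r,2n+m+s}+E_{2n+s,2n+m+r}\mapsto\theta_r\partial_{\vartheta_s}+\theta_s\partial_{\vartheta_r}$; $E_{i,2n+m+r}+E_{2n+r,n+i}\mapsto x_i\partial_{\vartheta_r}+\theta_r\partial_{y_i}$; $E_{n+i,2n+r}-E_{2n+m+r,i}\mapsto y_i\partial_{\theta_r}-\vartheta_r\partial_{x_i}$. This defines a representation of $osp(2n|2m)$ on $\mathcal{A}$. For $k\in\mathbb{N}$, $\mathcal{A}_k$ is the span of monomials $x^\alpha y^\beta\theta_{i_1}\cdots\theta_{i_a}\vartheta_{j_1}\cdots\vartheta_{j_b}$ with $|\alpha|+|\beta|+a+b=k$ (total degree $k$). $\Delta=\sum_{i=1}^n\partial_{x_i}\partial_{y_i}+\sum_{r=1}^m\partial_{\theta_r}\partial_{\vartheta_r}$, $\eta=\sum_{i=1}^nx_iy_i+\sum_{r=1}^m\theta_r\vartheta_r$ (multiplication), and $\mathcal{H}_k=\{f\in\mathcal{A}_k\mid\Delta(f)=0\}$,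 an $osp(2n|2m)$-submodule. *)

(* Defs.v *)
From HB Require Import structures.
From mathcomp Require Import all_boot all_order all_algebra.
From mathcomp.real_closed Require Import complex.
From mathcomp Require Import Rstruct.
Set Implicit Arguments.
Unset Strict Implicit.
Unset Printing Implicit Defensive.
Import Order.TTheory GRing.Theory Num.Theory.
Local Open Scope ring_scope.

Definition CC : numClosedFieldType := complex Rdefinitions.R.

(* A monomial  x^alpha y^beta theta_S vartheta_T, where the odd part is the
   ordered product  theta_{s1}...theta_{sa} vartheta_{t1}...vartheta_{tb}
   with s1<...<sa, t1<...<tb.  These monomials form a basis of A. *)
Record mono (n m : nat) := Mono {
  ex : {ffun 'I_n -> nat};
  ey : {ffun 'I_n -> nat};
  eth : {set 'I_m};
  evt : {set 'I_m}
}.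

(* An element of A is given by its coefficient family on the monomial basis.
   (We allow arbitrary families; the homogeneous components A_k, the only
   spaces the theorem talks about, automatically have finite support.) *)
Definition spoly (n m : nat) := mono n m -> CC.

Section Ops.
Variables n m : nat.
Implicit Types (f g : spoly n m) (z : mono n m).

Definition deg z : nat :=
  (\sum_i ex z i + \sum_i ey z i + #|eth z| + #|evt z|)%N.

Definition ffinc (a : {ffun 'I_n -> nat}) i := [ffun j => (a j + (j == i))%N].
Definition ffdec (a : {ffun 'I_n -> nat}) i := [ffun j => (a j - (j == i))%N].

Definition set_ex z a := Mono a (ey z) (eth z) (evt z).
Definition set_ey z a := Mono (ex z) a (eth z) (evt z).
Definition set_eth z S := Mono (ex z) (ey z) S (evt z).
Definition set_evt z T := Mono (ex z) (ey z) (eth z) T.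

Definition cnt_lt (S : {set 'I_m}) (r : 'I_m) : nat := #|[set s in S | (s < r)%N]|.

Definition pzero : spoly n m := fun _ => 0.
Definition padd f g : spoly n m := fun z => f z + g z.
Definition psub f g : spoly n m := fun z => f z - g z.
Definition pscale (c : CC) f : spoly n m := fun z => c * f z.

Definition mulx i f : spoly n m := fun z =>
  if (0 < ex z i)%N then f (set_ex z (ffdec (ex z) i)) else 0.
Definition muly i f : spoly n m := fun z =>
  if (0 < ey z i)%N then f (set_ey z (ffdec (ey z) i)) else 0.
Definition dx i f : spoly n m := fun z =>
  (ex z i).+1%:R * f (set_ex z (ffinc (ex z) i)).
Definition dy i f : spoly n m := fun z =>
  (ey z i).+1%:R * f (set_ey z (ffinc (ey z) i)).
(* theta_r * (theta_S vartheta_T) = (-1)^{#{s in S, s<r}} theta_{S+r} vartheta_T *)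
Definition multh r f : spoly n m := fun z =>
  if r \in eth z then (-1) ^+ cnt_lt (eth z) r * f (set_eth z (eth z :\ r)) else 0.
(* vartheta_r * (theta_S vartheta_T) = (-1)^{|S| + #{t in T, t<r}} theta_S vartheta_{T+r} *)
Definition mulvt r f : spoly n m := fun z =>
  if r \in evt z then (-1) ^+ (#|eth z| + cnt_lt (evt z) r)
                      * f (set_evt z (evt z :\ r)) else 0.
(* odd (left) derivations, satisfying the super Leibniz rule *)
Definition dth r f : spoly n m := fun z =>
  if r \in eth z then 0 else (-1) ^+ cnt_lt (eth z) r * f (set_eth z (r |: eth z)).
Definition dvt r f : spoly n m := fun z =>
  if r \in evt z then 0 else (-1) ^+ (#|eth z| + cnt_lt (evt z) r)
                                * f (set_evt z (r |: evt z)).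

Definition lap f : spoly n m := fun z =>
  \sum_i dx i (dy i f) z + \sum_r dth r (dvt r f) z.
Definition eta f : spoly n m := fun z =>
  \sum_i mulx i (muly i f) z + \sum_r multh r (mulvt r f) z.

Definition Ak (k : nat) f : Prop := forall z, f z != 0 -> deg z = k.
Definition Hk (k : nat) f : Prop := Ak k f /\ forall z, lap f z = 0.

Definition subspace (W : spoly n m -> Prop) : Prop :=
  [/\ W pzero, (forall f g, W f -> W g -> W (padd f g))
    & (forall c f, W f -> W (pscale c f))].

(* W is stable under the operators representing the spanning elements of
   osp(2n|2m) listed in the paper (hence under all of osp(2n|2m)). *)
Definition osp_stable (W : spoly n m -> Prop) : Prop :=
  forall f, W f ->
  [/\ (forall i j : 'I_n, W (psub (mulx i (dx j f)) (muly j (dy i f)))),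
      (forall r s : 'I_m, W (psub (multh r (dth s f)) (mulvt s (dvt r f)))),
      (forall i r, W (psub (mulx i (dth r f)) (mulvt r (dy i f)))),
      (forall i r, W (padd (multh r (dx i f)) (muly i (dvt r f)))) &
      (forall i j : 'I_n, (i < j)%N -> W (psub (mulx i (dy j f)) (mulx j (dy i f))))] /\
   [/\ (forall i j : 'I_n, (i < j)%N -> W (psub (muly i (dx j f)) (muly j (dx i f)))),
      (forall r s : 'I_m, (r <= s)%N -> W (padd (mulvt r (dth s f)) (mulvt s (dth r f)))),
      (forall r s : 'I_m, (r <= s)%N -> W (padd (multh r (dvt s f)) (multh s (dvt r f)))),
      (forall i r, W (padd (mulx i (dvt r f)) (multh r (dy i f)))) &
      (forall i r, W (psub (muly i (dth r f)) (mulvt r (dx i f))))].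

Definition irreducible (V : spoly n m -> Prop) : Prop :=
  [/\ subspace V, osp_stable V, (exists f, V f /\ exists z, f z != 0)
    & forall W, subspace W -> osp_stable W -> (forall f, W f -> V f) ->
        (forall f, W f -> forall z, f z = 0) \/ (forall f, V f -> W f)].

Definition etaH (i j : nat) f : Prop :=
  exists h, Hk j h /\ forall z, f z = iter i eta h z.

End Ops.

(* Main.v *)
(* Write x = x_1, y = y_1, and call the other variables transversal.

   A nonzero submodule W of H_k contains a nonzero f killed by all operators
   X_t = x d_t -+ t' d_y (t transversal, t' dual to t), since these raise the
   difference of the exponents of x and y.  As n > 1, comparing coefficients in
   x d_{y_2} f = x_2 d_y f shows that in each monomial of f the exponent of y
   is at most that of x; X_t f = 0 together with Delta f = 0 then makes d_y f an
   eigenvector of x d_x - y d_y with eigenvalue 2(m + 1 - n) - (k - 1), which is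
   impossible unless d_y f = 0 when k is outside ]m+1-n, 2(m+1-n)].  Hence f is
   a multiple of x^k.

   Conversely, modulo eta A_{k-2} (where x y = - eta', eta' the transversal part
   of eta), the lowering operators t d_x -+ y d_t' applied to x^k reach every
   x^(k-l) g with g transversal of degree l, then every y^c g, then all of A_k;
   the only denominators are the same k + d + 2(n - m - 1).  So
   A_k = W + eta A_{k-2}; moreover H_k and eta A_{k-2} meet trivially because
   their intersection is a submodule not containing x^k.  Thus W = H_k.

   In the excluded range eta^b H_{k-2b} with b = k - (m+1-n) is a proper
   submodule of H_k, by Delta eta^b h = b (n - m + deg h + b - 1) eta^(b-1) h;
   the same formula gives the direct sum. *)
From HB Require Import structures.
Require Import Defs.
From mathcomp Require Import all_boot all_order all_algebra.
From mathcomp Require Import boolp functions.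
From mathcomp Require Import zify ring.

Set Implicit Arguments.
Unset Strict Implicit.
Unset Printing Implicit Defensive.
Import Order.TTheory GRing.Theory Num.Theory.

(** The pointwise module structure, for which [padd], [psub] and [pscale] are convertible to the
    generic operations. *)
HB.instance Definition _ (n m : nat) :=
  GRing.Lmodule.copy (spoly n m) (mono n m -> (CC^o)%R).

(** * Weyl and Clifford relations between variables and derivations *)

Section Weyl.
Local Open Scope ring_scope.
Variables n m : nat.
Implicit Types (f g : spoly n m) (z : mono n m).

Lemma ffincC (a : {ffun 'I_n -> nat}) i j :
  ffinc (ffinc a i) j = ffinc (ffinc a j) i.
Proof. by apply/ffunP => l; rewrite !ffunE addnAC. Qed.

Lemma ffdecC (a : {ffun 'I_n -> nat}) i j :
  ffdec (ffdec a i) j = ffdec (ffdec a j) i.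
Proof. by apply/ffunP => l; rewrite !ffunE subnAC. Qed.

Lemma ffdec_incC (a : {ffun 'I_n -> nat}) i j :
  i != j -> ffdec (ffinc a i) j = ffinc (ffdec a j) i.
Proof.
move=> ij; apply/ffunP => l; rewrite !ffunE.
by case: (eqVneq l i) => [->|]; rewrite ?(negPf ij) ?subn0 ?addn0.
Qed.

Lemma ffincK (a : {ffun 'I_n -> nat}) i : ffdec (ffinc a i) i = a.
Proof. by apply/ffunP => l; rewrite !ffunE addnK. Qed.

Lemma ffdecK (a : {ffun 'I_n -> nat}) i :
  (0 < a i)%N -> ffinc (ffdec a i) i = a.
Proof.
by move=> a0; apply/ffunP => l; rewrite !ffunE subnK //; case: eqP => // ->.
Qed.

Lemma cnt_ltU1 (S : {set 'I_m}) r s :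
  r \notin S -> cnt_lt (r |: S) s = ((r < s)%N + cnt_lt S s)%N.
Proof.
move=> rS; rewrite /cnt_lt (cardsD1 r) !inE eqxx /=; congr (_ + _)%N.
apply: eq_card => t; rewrite !inE; case: (eqVneq t r) => [->|] //=.
by rewrite (negPf rS).
Qed.

Lemma cnt_ltD1 (S : {set 'I_m}) r s :
  r \in S -> cnt_lt S s = ((r < s)%N + cnt_lt (S :\ r) s)%N.
Proof.
by move=> rS; rewrite -{1}(setD1K rS) cnt_ltU1 // !inE eqxx.
Qed.

Lemma setD1C (S : {set 'I_m}) i j : S :\ i :\ j = S :\ j :\ i.
Proof. by rewrite !setDDl setUC. Qed.

Lemma setU1_D1C (S : {set 'I_m}) i j :
  i != j -> (i |: S) :\ j = i |: (S :\ j).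
Proof.
by move=> ij; rewrite setDUl; congr (_ :|: _); apply/setDidPl; rewrite disjoints1 inE.
Qed.

(** One index type for x, y (left summand) and theta, vartheta (right summand), so that a single
    relation up to sign covers all pairs of variables. *)
Definition var := (('I_n + 'I_n) + ('I_m + 'I_m))%type.
Implicit Types u v w : var.

Definition par v : bool := if v is inr _ then true else false.
Definition dual v : var :=
  match v with
  | inl (inl i) => inl (inr i)
  | inl (inr i) => inl (inl i)
  | inr (inl r) => inr (inr r)
  | inr (inr r) => inr (inl r)
  end.
Definition mul v f : spoly n m :=
  match v with
  | inl (inl i) => mulx i f
  | inl (inr i) => muly i f
  | inr (inl r) => multh r f
  | inr (inr r) => mulvt r f
  end.
Definition der v f : spoly n m :=
  match v with
  | inl (inl i) => dx i f
  | inl (inr i) => dy i f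
  | inr (inl r) => dth r f
  | inr (inr r) => dvt r f
  end.
(** The Koszul sign. *)
Definition sg u v : CC := (-1) ^+ (par u && par v).
Definition expo v z : nat :=
  match v with
  | inl (inl i) => ex z i
  | inl (inr i) => ey z i
  | inr (inl r) => r \in eth z
  | inr (inr r) => r \in evt z
  end.

Lemma sgC u v : sg u v = sg v u.
Proof. by rewrite /sg andbC. Qed.
Lemma sgK u v : sg u v * sg u v = 1.
Proof. by rewrite /sg -expr2 sqrr_sign. Qed.
Lemma dualK : involutive dual.
Proof. by case=> [[]|[]]. Qed.
Lemma par_dual v : par (dual v) = par v.
Proof. by case: v => [[]|[]]. Qed.
Lemma sg_dual u v : sg (dual u) v = sg u v.
Proof. by rewrite /sg par_dual. Qed.
Lemma sg_dualr u v : sg u (dual v) = sg u v.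
Proof. by rewrite /sg par_dual. Qed.
Lemma dual_neq v : (dual v == v) = false.
Proof. by case: v => [[]|[]]. Qed.

Lemma lincombE c f g z : (c *: f + g) z = c * f z + g z.
Proof. by []. Qed.

Lemma mul_linear v : linear (mul v).
Proof.
move=> c f g; apply/funext => z; rewrite lincombE.
case: v => [[]|[]] i; rewrite /mul /mulx /muly /multh /mulvt; case: ifP => _;
  by rewrite ?lincombE ?mulr0 ?addr0 //; ring.
Qed.
HB.instance Definition _ v := GRing.isLinear.Build CC (spoly n m) (spoly n m) _
  (mul v) (mul_linear v).

Lemma der_linear v : linear (der v).
Proof.
move=> c f g; apply/funext => z; rewrite lincombE.
case: v => [[]|[]] i; rewrite /der /dx /dy /dth /dvt; try case: ifP => _;
  by rewrite ?lincombE ?mulr0 ?addr0 //; ring.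
Qed.
HB.instance Definition _ v := GRing.isLinear.Build CC (spoly n m) (spoly n m) _
  (der v) (der_linear v).

Lemma oppE f z : (- f) z = - f z. Proof. by []. Qed.
Lemma addE f g z : (f + g) z = f z + g z. Proof. by []. Qed.
Lemma scaleE c f z : (c *: f) z = c * f z. Proof. by []. Qed.
Lemma zeroE z : (0 : spoly n m) z = 0. Proof. by []. Qed.
Lemma sumE (I : Type) (r : seq I) (P : pred I) (F : I -> spoly n m) z :
  (\sum_(i <- r | P i) F i) z = \sum_(i <- r | P i) F i z.
Proof. by elim/big_rec2: _ => // i y g _ <-. Qed.

(** Reduces each anticommutation check below to a parity count within reach of [lia]. *)
Lemma signD1 a b : ((a + b) %% 2 = 1)%N -> (-1) ^+ a = - (-1) ^+ b :> CC.
Proof.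
move=> ab; have : odd (a + b) by move: ab; rewrite modn2; case: odd.
by rewrite oddD -signr_odd -[in RHS]signr_odd; do 2 case: odd; rewrite //= ?expr0 ?expr1 ?opprK.
Qed.

Lemma mulC u v f : mul u (mul v f) = sg u v *: mul v (mul u f).
Proof.
(* Since [sg u v] squares to 1, the relation is symmetric in u and v; only types in the order x, y,
   theta, vartheta remain. *)
wlog: u v / match u, v with
  | inr _, inl _ | inl (inr _), inl (inl _) | inr (inr _), inr (inl _) => false
  | _, _ => true end.
  move=> H; case: u v => [[]|[]] i [[]|[]] j; try exact: H;
    by rewrite [X in _ = _ *: X]H // scalerA [X in X * _]sgC sgK scale1r.
case: u v => [[]|[]] i [[]|[]] j //= _; apply/funext => z;
  rewrite scaleE /sg /= ?expr0 ?expr1 ?mul1r ?mulN1r;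
  try by rewrite /mulx /muly /multh /mulvt /=; do 2 case: ifP => //=; rewrite ?mulr0.
- rewrite /mulx /= !ffunE; case: (eqVneq i j) => [->//|ij].
  by rewrite !subn0 ffdecC; do 2 case: ifP.
- rewrite /muly /= !ffunE; case: (eqVneq i j) => [->//|ij].
  by rewrite !subn0 ffdecC; do 2 case: ifP.
- rewrite /multh /= !inE; case: (eqVneq i j) => [->/=|ij].
    by rewrite mulr0 if_same oppr0.
  rewrite /=; case: ifP => iS; case: ifP => jS; rewrite ?mulr0 ?oppr0 ?mulrA -?exprD //.
  rewrite -mulNr (setD1C _ i); congr (_ * f _).
  (* Exactly one of i < j and j < i holds, so the position counts on the two sides differ in
     parity. *)
  apply: signD1; have := cnt_ltD1 j iS; have := cnt_ltD1 i jS.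
  by have := ij; rewrite -val_eqE /=; lia.
- rewrite /multh /mulvt /=; case: ifP => iS; case: ifP => jS;
    rewrite ?mulr0 ?oppr0 ?mulrA -?exprD //.
  rewrite -mulNr; congr (_ * f _).
  apply: signD1; rewrite (cardsD1 i (eth z)) iS /=; move: #|_| => c; lia.
- rewrite /mulvt /= !inE; case: (eqVneq i j) => [->/=|ij].
    by rewrite mulr0 if_same oppr0.
  rewrite /=; case: ifP => iS; case: ifP => jS; rewrite ?mulr0 ?oppr0 ?mulrA -?exprD //.
  rewrite -mulNr (setD1C _ i); congr (_ * f _).
  apply: signD1; have := cnt_ltD1 j iS; have := cnt_ltD1 i jS.
  by have := ij; rewrite -val_eqE /=; lia.
Qed.

Lemma derC u v f : der u (der v f) = sg u v *: der v (der u f).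
Proof.
wlog: u v / match u, v with
  | inr _, inl _ | inl (inr _), inl (inl _) | inr (inr _), inr (inl _) => false
  | _, _ => true end.
  move=> H; case: u v => [[]|[]] i [[]|[]] j; try exact: H;
    by rewrite [X in _ = _ *: X]H // scalerA [X in X * _]sgC sgK scale1r.
case: u v => [[]|[]] i [[]|[]] j //= _; apply/funext => z;
  rewrite scaleE /sg /= ?expr0 ?expr1 ?mul1r ?mulN1r.
- rewrite /dx /= ffincC !ffunE; case: (eqVneq i j) => [->//|ij].
  by rewrite !addn0 mulrCA.
- by rewrite /dx /dy mulrCA.
- by rewrite /dx /dth /=; case: ifP => _; rewrite ?mulr0 // mulrCA.
- by rewrite /dx /dvt /=; case: ifP => _; rewrite ?mulr0 // mulrCA.
- rewrite /dy /= ffincC !ffunE; case: (eqVneq i j) => [->//|ij].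
  by rewrite !addn0 mulrCA.
- by rewrite /dy /dth /=; case: ifP => _; rewrite ?mulr0 // mulrCA.
- by rewrite /dy /dvt /=; case: ifP => _; rewrite ?mulr0 // mulrCA.
- rewrite /dth /= !inE; case: (eqVneq i j) => [->/=|ij].
    by rewrite mulr0 if_same oppr0.
  rewrite /=; case: ifP => iS; case: ifP => jS; rewrite ?mulr0 ?oppr0 ?mulrA -?exprD //.
  rewrite -mulNr setUCA; congr (_ * f _).
  apply: signD1; rewrite !cnt_ltU1 ?iS ?jS //.
  by have := ij; rewrite -val_eqE /=; lia.
- rewrite /dth /dvt /= ; case: ifP => iS; case: ifP => jS; rewrite ?mulr0 ?oppr0 ?mulrA -?exprD //.
  rewrite -mulNr; congr (_ * f _).
  apply: signD1; rewrite cardsU1 iS /=; move: #|_| => c; lia.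
- rewrite /dvt /= !inE; case: (eqVneq i j) => [->/=|ij].
    by rewrite mulr0 if_same oppr0.
  rewrite /=; case: ifP => iS; case: ifP => jS; rewrite ?mulr0 ?oppr0 ?mulrA -?exprD //.
  rewrite -mulNr setUCA; congr (_ * f _).
  apply: signD1; rewrite !cnt_ltU1 ?iS ?jS //.
  by have := ij; rewrite -val_eqE /=; lia.
Qed.

(** Weyl relations for even variables, Clifford relations for odd ones. Together with [mulC] and
    [derC] they yield all commutators of [Lap], [Eta], [Eul] and [gen] below. *)
Lemma der_mul u v f :
  der u (mul v f) = (u == v)%:R *: f + sg u v *: mul v (der u f).
Proof.
case: u v => [[]|[]] i [[]|[]] j; apply/funext => z;
  rewrite addE !scaleE /sg /= ?expr0 ?expr1 ?mul1r ?mulN1r ?[_ == _]/=.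
- rewrite /dx /mulx /= !ffunE; case: (eqVneq i j) => [<-|ij].
    rewrite eqxx addn1 subn1 mul1r /= ffincK.
    case: z => a b S T; rewrite /set_ex /=; case: ifP => [a0|].
      by rewrite ffdecK // prednK // -nat1r mulrDl mul1r.
    by case: (a i) => // _; rewrite mul1r addr0.
  rewrite (_ : (_ == _) = false); last by apply/negbTE; move: ij; apply: contra => /eqP[->].
  rewrite mul0r add0r addn0 subn0 ffdec_incC //.
  by case: ifP; rewrite ?mulr0.
- by rewrite mul0r add0r /dx /muly /=; case: ifP => _; rewrite ?mulr0.
- by rewrite mul0r add0r /dx /multh /=; case: ifP => _; rewrite ?mulr0 // mulrCA.
- by rewrite mul0r add0r /dx /mulvt /=; case: ifP => _; rewrite ?mulr0 // mulrCA.
- by rewrite mul0r add0r /dy /mulx /=; case: ifP => _; rewrite ?mulr0.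
- rewrite /dy /muly /= !ffunE; case: (eqVneq i j) => [<-|ij].
    rewrite eqxx addn1 subn1 mul1r /= ffincK.
    case: z => a b S T; rewrite /set_ey /=; case: ifP => [a0|].
      by rewrite ffdecK // prednK // -nat1r mulrDl mul1r.
    by case: (b i) => // _; rewrite mul1r addr0.
  rewrite (_ : (_ == _) = false); last by apply/negbTE; move: ij; apply: contra => /eqP[->].
  rewrite mul0r add0r addn0 subn0 ffdec_incC //.
  by case: ifP; rewrite ?mulr0.
- by rewrite mul0r add0r /dy /multh /=; case: ifP => _; rewrite ?mulr0 // mulrCA.
- by rewrite mul0r add0r /dy /mulvt /=; case: ifP => _; rewrite ?mulr0 // mulrCA.
- by rewrite mul0r add0r /mulx /dth /=; do 2 case: ifP => _; rewrite ?mulr0.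
- by rewrite mul0r add0r /muly /dth /=; do 2 case: ifP => _; rewrite ?mulr0.
- rewrite /dth /multh /= !inE; case: (eqVneq i j) => [<-|ij].
    rewrite !eqxx mul1r /=; case: z => a b S T; rewrite /set_eth /=; case: ifP => iS.
      rewrite mulrA -exprD setD1K // (cnt_ltD1 i iS) ltnn add0n addnn.
      by rewrite -signr_odd odd_double mul1r subrr.
    rewrite cnt_ltU1 ?iS // ltnn add0n mulrA -exprD addnn -signr_odd odd_double.
    by rewrite mul1r setU1K ?iS // oppr0 addr0.
  rewrite (_ : (_ == _) = false); last by apply/negbTE; move: ij; apply: contra => /eqP[->].
  rewrite mul0r add0r /=.
  case: ifP => iS; case: ifP => jS; rewrite ?mulr0 ?oppr0 // !mulrA -!exprD -mulNr.
  rewrite setU1_D1C //; congr (_ * f _).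
  apply: signD1; rewrite cnt_ltU1 ?iS // (cnt_ltD1 i jS).
  by have := ij; rewrite -val_eqE /=; lia.
- rewrite mul0r add0r /dth /mulvt /=.
  case: ifP => iS; case: ifP => jS; rewrite ?mulr0 ?oppr0 // !mulrA -!exprD -mulNr.
  congr (_ * f _); apply: signD1; rewrite cardsU1 iS /=; move: #|_| => c; lia.
- by rewrite mul0r add0r /mulx /dvt /=; do 2 case: ifP => _; rewrite ?mulr0.
- by rewrite mul0r add0r /muly /dvt /=; do 2 case: ifP => _; rewrite ?mulr0.
- rewrite mul0r add0r /dvt /multh /=.
  case: ifP => iS; case: ifP => jS; rewrite ?mulr0 ?oppr0 // !mulrA -!exprD -mulNr.
  congr (_ * f _); apply: signD1; rewrite (cardsD1 j (eth z)) jS /=; move: #|_| => c; lia.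
- rewrite /dvt /mulvt /= !inE; case: (eqVneq i j) => [<-|ij].
    rewrite !eqxx mul1r /=; case: z => a b S T; rewrite /set_evt /=; case: ifP => iS.
      rewrite mulrA -exprD setD1K // (cnt_ltD1 i iS) ltnn add0n addnn.
      by rewrite -signr_odd odd_double mul1r subrr.
    rewrite cnt_ltU1 ?iS // ltnn add0n mulrA -exprD addnn -signr_odd odd_double.
    by rewrite mul1r setU1K ?iS // oppr0 addr0.
  rewrite (_ : (_ == _) = false); last by apply/negbTE; move: ij; apply: contra => /eqP[->].
  rewrite mul0r add0r /=.
  case: ifP => iS; case: ifP => jS; rewrite ?mulr0 ?oppr0 // !mulrA -!exprD -mulNr.
  rewrite setU1_D1C //; congr (_ * f _).
  apply: signD1; rewrite cnt_ltU1 ?iS // (cnt_ltD1 i jS).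
  by have := ij; rewrite -val_eqE /=; lia.
Qed.

End Weyl.

(** * Laplacian, eta, Euler operator and generators of osp; exponents and supports *)

Section Osp.
Local Open Scope ring_scope.
Variables n m : nat.
Implicit Types (f g : spoly n m) (z : mono n m) (u v w : var n m).

(* The signs for which 2 Delta and 2 eta are the sums over all variables v of
   lam v d_v d_(dual v) and lam v v (dual v). *)
Definition lam v : CC := if v is inr (inr _) then -1 else 1.

Lemma lamK v : lam v * lam v = 1.
Proof. by case: v => [[]|[]] ? /=; rewrite ?mulrNN mulr1. Qed.
(** By this supersymmetry both orders of a dual pair contribute equally to [Lap] and [Eta]. *)
Lemma lam_dual v : lam (dual v) = sg v v * lam v.
Proof. by case: v => [[]|[]] ? /=; rewrite /sg /= ?expr0 ?expr1 ?mulrNN ?mulr1. Qed.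

Lemma mulDr v f g : mul v (f + g) = mul v f + mul v g. Proof. exact: linearD. Qed.
Lemma mulZr v c f : mul v (c *: f) = c *: mul v f. Proof. exact: linearZ. Qed.
Lemma mulBr v f g : mul v (f - g) = mul v f - mul v g. Proof. exact: linearB. Qed.
Lemma derBr v f g : der v (f - g) = der v f - der v g. Proof. exact: linearB. Qed.
Lemma derDr v f g : der v (f + g) = der v f + der v g. Proof. exact: linearD. Qed.
Lemma derZr v c f : der v (c *: f) = c *: der v f. Proof. exact: linearZ. Qed.

Lemma sum_var (V : nmodType) (F : var n m -> V) :
  \sum_v F v = \sum_i F (inl (inl i)) + \sum_i F (inl (inr i))
             + (\sum_r F (inr (inl r)) + \sum_r F (inr (inr r))).
Proof. by rewrite big_sumType /= !big_sumType. Qed.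

Definition Lap f : spoly n m := \sum_v lam v *: der v (der (dual v) f).
Definition Eta f : spoly n m := \sum_v lam v *: mul v (mul (dual v) f).
Definition Eul f : spoly n m := \sum_v mul v (der v f).

Lemma Lap_linear : linear Lap.
Proof.
move=> c f g; rewrite /Lap scaler_sumr -big_split; apply: eq_bigr => v _ /=.
by rewrite !(derDr, derZr, mulDr, mulZr) scalerDr !scalerA mulrC.
Qed.
HB.instance Definition _ := GRing.isLinear.Build CC (spoly n m) (spoly n m) _
  Lap Lap_linear.

Lemma Eta_linear : linear Eta.
Proof.
move=> c f g; rewrite /Eta scaler_sumr -big_split; apply: eq_bigr => v _ /=.
by rewrite !(derDr, derZr, mulDr, mulZr) scalerDr !scalerA mulrC.
Qed.
HB.instance Definition _ := GRing.isLinear.Build CC (spoly n m) (spoly n m) _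
  Eta Eta_linear.

Lemma Eul_linear : linear Eul.
Proof.
move=> c f g; rewrite /Eul scaler_sumr -big_split; apply: eq_bigr => v _ /=.
by rewrite !(derDr, derZr, mulDr, mulZr).
Qed.
HB.instance Definition _ := GRing.isLinear.Build CC (spoly n m) (spoly n m) _
  Eul Eul_linear.

Lemma LapB f g : Lap (f - g) = Lap f - Lap g. Proof. exact: linearB. Qed.
Lemma LapD f g : Lap (f + g) = Lap f + Lap g. Proof. exact: linearD. Qed.
Lemma LapZ c f : Lap (c *: f) = c *: Lap f. Proof. exact: linearZ. Qed.
Lemma EtaB f g : Eta (f - g) = Eta f - Eta g. Proof. exact: linearB. Qed.
Lemma EtaD f g : Eta (f + g) = Eta f + Eta g. Proof. exact: linearD. Qed.
Lemma EtaZ c f : Eta (c *: f) = c *: Eta f. Proof. exact: linearZ. Qed.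
Lemma EulB f g : Eul (f - g) = Eul f - Eul g. Proof. exact: linearB. Qed.
Lemma EulD f g : Eul (f + g) = Eul f + Eul g. Proof. exact: linearD. Qed.
Lemma EulZ c f : Eul (c *: f) = c *: Eul f. Proof. exact: linearZ. Qed.

Lemma LapE f : Lap f = 2 *: lap f.
Proof.
have -> : lap f = \sum_i dx i (dy i f) + \sum_r dth r (dvt r f).
  by apply/funext => z; rewrite addE !sumE.
rewrite /Lap sum_var /=.
under [X in _ + X + _]eq_bigr do
  rewrite scale1r -/(der (inl (inl _)) f) -/(der (inl (inr _)) _) derC /sg /= expr0 scale1r.
under [X in _ + (_ + X)]eq_bigr do
  rewrite -/(der (inr (inl _)) f) -/(der (inr (inr _)) _) derC /sg /=
    expr1 scalerA mulrNN mul1r scale1r.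
under [X in X + _ + _]eq_bigr do rewrite scale1r.
under [X in _ + (X + _)]eq_bigr do rewrite scale1r.
by rewrite /der -!mulr2n -mulrnDl -scaler_nat.
Qed.

Lemma EtaE f : Eta f = 2 *: eta f.
Proof.
have -> : eta f = \sum_i mulx i (muly i f) + \sum_r multh r (mulvt r f).
  by apply/funext => z; rewrite addE !sumE.
rewrite /Eta sum_var /=.
under [X in _ + X + _]eq_bigr do
  rewrite scale1r -/(mul (inl (inl _)) f) -/(mul (inl (inr _)) _) mulC /sg /= expr0 scale1r.
under [X in _ + (_ + X)]eq_bigr do
  rewrite -/(mul (inr (inl _)) f) -/(mul (inr (inr _)) _) mulC /sg /=
    expr1 scalerA mulrNN mul1r scale1r.
under [X in X + _ + _]eq_bigr do rewrite scale1r.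
under [X in _ + (X + _)]eq_bigr do rewrite scale1r.
by rewrite /mul -!mulr2n -mulrnDl -scaler_nat.
Qed.

Lemma sum_delta (V : lmodType CC) w (F : var n m -> V) :
  \sum_v (v == w)%:R *: F v = F w.
Proof.
rewrite (bigD1 w) //= eqxx scale1r big1 ?addr0 // => v /negPf vw.
by rewrite vw scale0r.
Qed.

Lemma dual_eq u v : (dual u == v) = (u == dual v).
Proof. by rewrite -(inj_eq (can_inj (@dualK n m))) dualK. Qed.

Lemma der2_mul u v w f : der v (der u (mul w f)) =
  (sg v w * sg u w) *: mul w (der v (der u f)) + (u == w)%:R *: der v f
  + (v == w)%:R *: (sg u w *: der u f).
Proof.
rewrite der_mul derDr !derZr der_mul scalerDr !scalerA (mulrC (sg u w) (sg v w)).
by rewrite (mulrC (sg u w) _%:R) addrA addrC addrA.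
Qed.

(** Only the dual pair of w yields extra terms, once in each order; the two agree by [lam_dual],
    hence the factor 2. *)
Lemma Lap_mul w f :
  Lap (mul w f) = mul w (Lap f) + (2 * lam (dual w)) *: der (dual w) f.
Proof.
transitivity (mul w (Lap f)
    + \sum_v (v == dual w)%:R *: (lam v *: der v f)
    + \sum_v (v == w)%:R *: ((lam v * sg v w) *: der (dual v) f)).
  rewrite /Lap linear_sum -!big_split; apply: eq_bigr => v _ /=.
  rewrite der2_mul sg_dual sgK scale1r !scalerDr mulZr dual_eq !scalerA.
  by rewrite !mulrA (mulrC (lam v) (_ == dual w)%:R) (mulrC (lam v) (_ == w)%:R).
by rewrite !sum_delta -addrA -scalerDl mulr_natl mulr2n (mulrC (lam w)) -lam_dual.
Qed.

Lemma Lap_der w f : Lap (der w f) = der w (Lap f).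
Proof.
rewrite /Lap linear_sum; apply: eq_bigr => v _ /=.
rewrite derZr (derC (dual v)) derZr (derC v) !scalerA; congr (_ *: _).
by rewrite sg_dual -mulrA sgK mulr1.
Qed.

Lemma Eta_mul w f : Eta (mul w f) = mul w (Eta f).
Proof.
rewrite /Eta linear_sum; apply: eq_bigr => v _ /=.
rewrite mulZr (mulC (dual v)) mulZr (mulC v) !scalerA; congr (_ *: _).
by rewrite sg_dual -mulrA sgK mulr1.
Qed.

Lemma der_Eta w f : der w (Eta f) = Eta (der w f) + (2 * lam w) *: mul (dual w) f.
Proof.
transitivity (Eta (der w f)
    + \sum_v (v == w)%:R *: (lam v *: mul (dual v) f)
    + \sum_v (v == dual w)%:R *: ((lam v * sg v w) *: mul v f)).
  rewrite /Eta linear_sum -!big_split; apply: eq_bigr => v _ /=.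
  rewrite derZr der_mul der_mul mulDr !mulZr.
  rewrite !scalerDr !scalerA (eq_sym w v) (eq_sym w) dual_eq sg_dualr (sgC v w).
  rewrite -[X in X *: mul v (mul _ _)]mulrA sgK mulr1 (mulrC (lam v) _%:R).
  by rewrite [(v == dual w)%:R * _]mulrC addrA addrC addrA.
rewrite !sum_delta -addrA -scalerDl mulr_natl mulr2n.
by rewrite (lam_dual w) sg_dual -mulrA (mulrC (lam w)) mulrA sgK mul1r.
Qed.

Lemma Eul_mul w f : Eul (mul w f) = mul w (Eul f) + mul w f.
Proof.
rewrite -[X in _ + X](sum_delta w (fun v => mul v f)) /Eul linear_sum -big_split.
apply: eq_bigr => v _ /=.
by rewrite der_mul mulDr !mulZr mulC scalerA sgK scale1r addrC.
Qed.

Lemma Eul_der w f : Eul (der w f) = der w (Eul f) - der w f.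
Proof.
rewrite -[X in _ - X](sum_delta w (fun v => der v f)) /Eul linear_sum -sumrB.
apply: eq_bigr => v _ /=.
rewrite der_mul derC mulZr (sgC w v) eq_sym.
by case: (v == w); rewrite ?scale0r ?add0r ?subr0 // scale1r addrAC subrr add0r.
Qed.

(* Half of the superdimension 2n - 2m of the span of the variables. *)
Definition sdim : CC := n%:R - m%:R.

Lemma sum_sg : \sum_(v : var n m) sg v v = 2 * sdim.
Proof.
have sumc k (c : CC) : \sum_(i < k) c = c *+ k by rewrite sumr_const card_ord.
rewrite sum_var.
have -> : \sum_i sg (inl (inl i) : var n m) (inl (inl i)) = 1 *+ n by exact: sumc.
have -> : \sum_i sg (inr (inl i) : var n m) (inr (inl i)) = (-1) *+ m by exact: sumc.
rewrite mulNrn /sdim mulrBr.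
rewrite addrACA.
by rewrite mulr_natl mulr_natl !mulr2n addrACA opprD.
Qed.

(** The sl_2 relation. Each variable contributes Euler terms and a constant [sg v v], and these
    constants sum to the superdimension; the factor 4 arises because [Lap] and [Eta] are twice Delta
    and eta. *)
Lemma Lap_Eta f : Lap (Eta f) = Eta (Lap f) + 4 *: (Eul f + sdim *: f).
Proof.
transitivity (Eta (Lap f) + 2 *: (\sum_v (mul v (der v f) + sg v v *: f)
   + \sum_v mul (dual v) (der (dual v) f))).
  rewrite /Eta linear_sum -big_split scaler_sumr -big_split; apply: eq_bigr => v _ /=.
  rewrite linearZ /= Lap_mul Lap_mul mulDr dualK mulZr der_mul eqxx scale1r.
  rewrite !scalerDr !scalerA lam_dual sg_dual -!addrA; congr (_ + _).
  have l2 : lam v * lam v = 1 := lamK v; have s2 := sgK v v.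
  congr (_ *: _ + (_ *: _ + _ *: _)).
  - by rewrite mulrCA l2 mulr1.
  - rewrite (_ : lam v * _ = 2 * sg v v * (lam v * lam v)); last by ring.
    by rewrite l2 mulr1.
  - rewrite sg_dualr (_ : lam v * _ = 2 * (lam v * lam v) * (sg v v * sg v v)); last by ring.
    by rewrite l2 s2 !mulr1.
have -> : \sum_v mul (dual v) (der (dual v) f) = Eul f.
  by rewrite /Eul [RHS](reindex_inj (inv_inj (@dualK n m))).
rewrite big_split /= -scaler_suml sum_sg -/(Eul f) addrAC -mulr2n -scaler_nat.
rewrite scalerDr !scalerA scalerDr !scalerA.
by rewrite mulrA -natrM.
Qed.

(* The spanning elements of osp(2n|2m) in uniform notation, up to sign; the
   coefficient is the one making [gen u v] commute with Delta and eta. *)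
Definition gen u v f : spoly n m :=
  mul u (der v f) - (lam (dual u) * lam v * sg u v) *: mul (dual v) (der (dual u) f).

(** Moving [Lap] past u and past [dual v] creates the same second derivative up to sign; the
    coefficient in [gen] makes the two cancel. *)
Lemma Lap_gen u v f : Lap (gen u v f) = gen u v (Lap f).
Proof.
rewrite /gen LapB LapZ /= !Lap_mul !Lap_der dualK !scalerDr opprD.
rewrite addrACA -[RHS]addr0; congr (_ + _); apply/eqP; rewrite subr_eq0; apply/eqP.
rewrite (derC v) !scalerA; congr (_ *: _).
rewrite sg_dualr (sgC v u).
rewrite [RHS](_ : _ = 2 * lam (dual u) * (lam v * lam v) * (sg u v * sg u v)); last by ring.
by rewrite lamK sgK !mulr1.
Qed.

Lemma Eta_gen u v f : gen u v (Eta f) = Eta (gen u v f).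
Proof.
rewrite /gen EtaB EtaZ /= !Eta_mul !der_Eta.
rewrite !mulDr !mulZr dualK !scalerDr opprD.
rewrite addrACA -[RHS]addr0; congr (_ + _); apply/eqP; rewrite subr_eq0; apply/eqP.
rewrite (mulC u) !scalerA; congr (_ *: _).
rewrite sg_dualr.
rewrite [RHS](_ : _ = 2 * lam v * sg u v * (lam (dual u) * lam (dual u))); last by ring.
by rewrite lamK !mulr1.
Qed.

Lemma Eul_gen u v f : Eul (gen u v f) = gen u v (Eul f).
Proof.
rewrite /gen EulB EulZ /= !Eul_mul !Eul_der.
by rewrite !mulBr !subrK.
Qed.

Lemma gen_linear u v : linear (gen u v).
Proof.
move=> c f g; rewrite /gen !(derDr, derZr, mulDr, mulZr) scalerDr opprD addrACA.
by rewrite scalerBr !scalerA (mulrC c).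
Qed.
HB.instance Definition _ u v := GRing.isLinear.Build CC (spoly n m) (spoly n m) _
  (gen u v) (gen_linear u v).

(** The bridge from operator identities back to coefficients: exponents appear as eigenvalues. *)
Lemma mul_der v f z : mul v (der v f) z = (expo v z)%:R * f z.
Proof.
case: v z => [[]|[]] i [a b S T] /=.
- rewrite /mulx /dx /set_ex /= !ffunE eqxx subn1; case: ifP => [a0|].
    by rewrite ffdecK // prednK.
  by case: (a i) => //; rewrite mul0r.
- rewrite /muly /dy /set_ey /= !ffunE eqxx subn1; case: ifP => [a0|].
    by rewrite ffdecK // prednK.
  by case: (b i) => //; rewrite mul0r.
- rewrite /multh /dth /set_eth /= !inE eqxx /=; case: ifP => iS; last by rewrite mul0r.
  rewrite mulrA -exprD setD1K // (cnt_ltD1 i iS) ltnn add0n addnn.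
  by rewrite -signr_odd odd_double.
- rewrite /mulvt /dvt /set_evt /= !inE eqxx /=; case: ifP => iS; last by rewrite mul0r.
  rewrite mulrA -exprD setD1K // (cnt_ltD1 i iS) ltnn add0n addnn.
  by rewrite -signr_odd odd_double.
Qed.

Lemma deg_expo z : deg z = (\sum_v expo v z)%N.
Proof.
rewrite big_sumType /= !big_sumType /= addnA.
by congr (_ + _ + _ + _)%N; rewrite -sum1_card big_mkcond; apply: eq_bigr => r _; case: ifP.
Qed.

Lemma EulE f z : Eul f z = (deg z)%:R * f z.
Proof.
rewrite /Eul sumE deg_expo natr_sum mulr_suml.
by apply: eq_bigr => v _; rewrite mul_der.
Qed.

Lemma expo_inj z z' : (forall v, expo v z = expo v z') -> z = z'.
Proof.
case: z z' => [a b S T] [a' b' S' T'] E; congr Mono.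
- by apply/ffunP => i; exact: (E (inl (inl i))).
- by apply/ffunP => i; exact: (E (inl (inr i))).
- by apply/setP => i; move: (E (inr (inl i))) => /=; do 2 case: (_ \in _).
- by apply/setP => i; move: (E (inr (inr i))) => /=; do 2 case: (_ \in _).
Qed.

Lemma mul_supp v f z : mul v f z != 0 ->
  exists2 z', f z' != 0 & forall w, expo w z = (expo w z' + (w == v))%N.
Proof.
case: v z => [[]|[]] i [a b S T] /=.
- rewrite /mulx /=; case: ifP => [a0 fz|]; last by rewrite eqxx.
  exists (set_ex (Mono a b S T) (ffdec a i)) => //.
  case=> [[]|[]] j /=; rewrite ?[_ == _]/= ?addn0 // !ffunE.
  by rewrite subnK //; case: eqP => // ->.
- rewrite /muly /=; case: ifP => [a0 fz|]; last by rewrite eqxx.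
  exists (set_ey (Mono a b S T) (ffdec b i)) => //.
  case=> [[]|[]] j /=; rewrite ?[_ == _]/= ?addn0 // !ffunE.
  by rewrite subnK //; case: eqP => // ->.
- rewrite /multh /=; case: ifP => [a0|]; last by rewrite eqxx.
  rewrite mulf_eq0 negb_or => /andP[_ fz].
  exists (set_eth (Mono a b S T) (S :\ i)) => //.
  case=> [[]|[]] j /=; rewrite ?[_ == _]/= ?addn0 // !inE.
  by rewrite (inj_eq inr_inj) (inj_eq inl_inj); case: (eqVneq j i) => [->|_]; rewrite ?a0 ?addn0.
- rewrite /mulvt /=; case: ifP => [a0|]; last by rewrite eqxx.
  rewrite mulf_eq0 negb_or => /andP[_ fz].
  exists (set_evt (Mono a b S T) (T :\ i)) => //.
  case=> [[]|[]] j /=; rewrite ?[_ == _]/= ?addn0 // !inE.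
  by rewrite !(inj_eq inr_inj); case: (eqVneq j i) => [->|_]; rewrite ?a0 ?addn0.
Qed.

Lemma der_supp v f z : der v f z != 0 ->
  exists2 z', f z' != 0 & forall w, expo w z' = (expo w z + (w == v))%N.
Proof.
case: v z => [[]|[]] i [a b S T] /=.
- rewrite /dx /= mulf_eq0 negb_or => /andP[_ fz].
  exists (set_ex (Mono a b S T) (ffinc a i)) => //.
  by case=> [[]|[]] j /=; rewrite ?[_ == _]/= ?addn0 // !ffunE.
- rewrite /dy /= mulf_eq0 negb_or => /andP[_ fz].
  exists (set_ey (Mono a b S T) (ffinc b i)) => //.
  by case=> [[]|[]] j /=; rewrite ?[_ == _]/= ?addn0 // !ffunE.
- rewrite /dth /=; case: ifP => [|a0]; first by rewrite eqxx.
  rewrite mulf_eq0 negb_or => /andP[_ fz].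
  exists (set_eth (Mono a b S T) (i |: S)) => //.
  case=> [[]|[]] j /=; rewrite ?[_ == _]/= ?addn0 // !inE.
  by rewrite (inj_eq inr_inj) (inj_eq inl_inj); case: (eqVneq j i) => [->|_]; rewrite ?a0 ?addn0.
- rewrite /dvt /=; case: ifP => [|a0]; first by rewrite eqxx.
  rewrite mulf_eq0 negb_or => /andP[_ fz].
  exists (set_evt (Mono a b S T) (i |: T)) => //.
  case=> [[]|[]] j /=; rewrite ?[_ == _]/= ?addn0 // !inE.
  by rewrite !(inj_eq inr_inj); case: (eqVneq j i) => [->|_]; rewrite ?a0 ?addn0.
Qed.

(** In characteristic 0 a positive exponent keeps the coefficient of v d_v f at z nonzero, and that
    coefficient must come from d_v f. *)
Lemma der_neq0 v f z : f z != 0 -> (0 < expo v z)%N ->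
  exists2 z', der v f z' != 0 & forall w, expo w z = (expo w z' + (w == v))%N.
Proof.
move=> fz ez; apply: mul_supp; rewrite mul_der mulf_neq0 // pnatr_eq0.
by rewrite -lt0n.
Qed.

(** For even v, d_v v = 1 + v d_v scales the coefficient at z by a positive integer. *)
Lemma mul_neq0 v f z : par v = false -> f z != 0 ->
  exists2 z', mul v f z' != 0 & forall w, expo w z' = (expo w z + (w == v))%N.
Proof.
move=> pv fz; apply: der_supp; rewrite der_mul eqxx scale1r addE scaleE mul_der.
rewrite /sg pv /= expr0 mul1r -{1}[f z]mul1r -mulrDl mulf_neq0 //.
by rewrite nat1r pnatr_eq0.
Qed.

End Osp.

(** * Stable subspaces; A_k and H_k as eigenspaces *)

Section Stable.
Local Open Scope ring_scope.
Variables n m : nat.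
Implicit Types (f g h : spoly n m) (z : mono n m) (u v w t : var n m).
Implicit Types (W : spoly n m -> Prop) (k : nat).

Definition gen_stable W := forall u v f, W f -> W (gen u v f).

Section Subspace.
Variable W : spoly n m -> Prop.
Hypothesis sW : subspace W.

Lemma sub0 : W 0. Proof. by case: sW. Qed.
Lemma subD f g : W f -> W g -> W (f + g). Proof. by case: sW => _ H _; exact: H. Qed.
Lemma subZ c f : W f -> W (c *: f). Proof. by case: sW => _ _ H; exact: H. Qed.
Lemma subN f : W f -> W (- f). Proof. by rewrite -scaleN1r; exact: subZ. Qed.
Lemma subB f g : W f -> W g -> W (f - g).
Proof. by move=> Wf Wg; apply: subD => //; exact: subN. Qed.
Lemma sub_sum (I : Type) (r : seq I) (P : pred I) (F : I -> spoly n m) :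
  (forall i, P i -> W (F i)) -> W (\sum_(i <- r | P i) F i).
Proof. by move=> H; apply: big_rec => [|i f /H]; [exact: sub0 | exact: subD]. Qed.
Lemma subZ_inv c f : c != 0 -> W (c *: f) -> W f.
Proof. by move=> c0 /(subZ c^-1); rewrite scalerA mulVf // scale1r. Qed.
Lemma subD_inv f g : W g -> W (f + g) -> W f.
Proof. by move=> Wg Wfg; rewrite -(addrK g f); exact: subB. Qed.

(** Interchanging the two terms only changes the operator by a sign, so the listed spanning
    elements, with their restricted index ranges, account for every [gen u v]. *)
Lemma gen_dual u v f :
  gen (dual v) (dual u) f = - (lam (dual u) * lam v * sg u v) *: gen u v f.
Proof.
rewrite /gen !dualK sg_dual sg_dualr (sgC v) (mulrC (lam v)) scalerBr scalerA.
rewrite mulNr (_ : _ * (_ * _) =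
  (lam (dual u) * lam (dual u)) * (lam v * lam v) * (sg u v * sg u v)).
  by rewrite !lamK sgK !mulr1 !scaleNr scale1r opprK addrC.
by ring.
Qed.

Lemma sub_gen_dual u v f : W (gen u v f) -> W (gen (dual v) (dual u) f).
Proof. by rewrite gen_dual => H; apply: subZ. Qed.

Lemma psubE f g : psub f g = f - g. Proof. by []. Qed.
Lemma paddE f g : padd f g = f + g. Proof. by []. Qed.

Lemma gen_minus u v f : lam (dual u) * lam v * sg u v = 1 ->
  gen u v f = psub (mul u (der v f)) (mul (dual v) (der (dual u) f)).
Proof. by move=> e; rewrite /gen e scale1r. Qed.
Lemma gen_plus u v f : lam (dual u) * lam v * sg u v = -1 ->
  gen u v f = padd (mul u (der v f)) (mul (dual v) (der (dual u) f)).
Proof. by move=> e; rewrite /gen e scaleN1r opprK. Qed.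

Lemma gen_stable_osp : gen_stable W -> osp_stable W.
Proof.
move=> gW f Wf.
have gm u v : lam (dual u) * lam v * sg u v = 1 ->
  W (psub (mul u (der v f)) (mul (dual v) (der (dual u) f))).
  by move=> e; rewrite -gen_minus //; exact: gW.
have gp u v : lam (dual u) * lam v * sg u v = -1 ->
  W (padd (mul u (der v f)) (mul (dual v) (der (dual u) f))).
  by move=> e; rewrite -gen_plus //; exact: gW.
split; split=> i j.
- by apply: (gm (inl (inl i)) (inl (inl j))); rewrite /sg /= expr0 !mulr1.
- by apply: (gm (inr (inl i)) (inr (inl j))); rewrite /sg /= expr1 mulr1 mulrNN mulr1.
- by apply: (gm (inl (inl i)) (inr (inl j))); rewrite /sg /= expr0 !mulr1.
- by apply: (gp (inr (inl j)) (inl (inl i))); rewrite /sg /= expr0 !mulr1.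
- by move=> _; apply: (gm (inl (inl i)) (inl (inr j))); rewrite /sg /= expr0 !mulr1.
- by move=> _; apply: (gm (inl (inr i)) (inl (inl j))); rewrite /sg /= expr0 !mulr1.
- by move=> _; apply: (gp (inr (inr i)) (inr (inl j))); rewrite /sg /= expr1 !mul1r.
- by move=> _; apply: (gp (inr (inl i)) (inr (inr j))); rewrite /sg /= expr1 mulrNN mul1r mul1r.
- by apply: (gp (inl (inl i)) (inr (inr j))); rewrite /sg /= expr0 mul1r mulr1.
- by apply: (gm (inl (inr i)) (inr (inl j))); rewrite /sg /= expr0 !mulr1.
Qed.

Lemma osp_gen_stable : osp_stable W -> gen_stable W.
Proof.
move=> oW u v f Wf.
have [[xx tt xt tx xy] [yx vt tv xv yt]] := oW f Wf.
have gxx i j : W (gen (inl (inl i)) (inl (inl j)) f).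
  by rewrite gen_minus; [exact: xx | rewrite /sg /= expr0 !mulr1].
have gtt i j : W (gen (inr (inl i)) (inr (inl j)) f).
  by rewrite gen_minus; [exact: tt | rewrite /sg /= expr1 mulr1 mulrNN mulr1].
have gxt i j : W (gen (inl (inl i)) (inr (inl j)) f).
  by rewrite gen_minus; [exact: xt | rewrite /sg /= expr0 !mulr1].
have gtx i j : W (gen (inr (inl j)) (inl (inl i)) f).
  by rewrite gen_plus; [exact: tx | rewrite /sg /= expr0 !mulr1].
have gxv i j : W (gen (inl (inl i)) (inr (inr j)) f).
  by rewrite gen_plus; [exact: xv | rewrite /sg /= expr0 mul1r mulr1].
have gyt i j : W (gen (inl (inr i)) (inr (inl j)) f).
  by rewrite gen_minus; [exact: yt | rewrite /sg /= expr0 !mulr1].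
have gxy (i j : 'I_n) : (i < j)%N -> W (gen (inl (inl i)) (inl (inr j)) f).
  by move=> ij; rewrite gen_minus; [exact: xy | rewrite /sg /= expr0 !mulr1].
have gyx (i j : 'I_n) : (i < j)%N -> W (gen (inl (inr i)) (inl (inl j)) f).
  by move=> ij; rewrite gen_minus; [exact: yx | rewrite /sg /= expr0 !mulr1].
have gvt (i j : 'I_m) : (i <= j)%N -> W (gen (inr (inr i)) (inr (inl j)) f).
  by move=> ij; rewrite gen_plus; [exact: vt | rewrite /sg /= expr1 !mul1r].
have gtv (i j : 'I_m) : (i <= j)%N -> W (gen (inr (inl i)) (inr (inr j)) f).
  by move=> ij; rewrite gen_plus; [exact: tv | rewrite /sg /= expr1 mulrNN mul1r mul1r].
case: u v => [[]|[]] i [[]|[]] j //.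
- case: (ltngtP i j) => [/gxy//|/gxy H|/ord_inj ->].
    exact: (sub_gen_dual H).
  (* For equal indices the two terms coincide and the generator is zero. *)
  rewrite gen_minus; last by rewrite /sg /= expr0 !mulr1.
  by rewrite psubE subrr; exact: sub0.
- case: (ltngtP i j) => [/gyx//|/gyx H|/ord_inj ->].
    exact: (sub_gen_dual H).
  rewrite gen_minus; last by rewrite /sg /= expr0 !mulr1.
  by rewrite psubE subrr; exact: sub0.
- exact: (sub_gen_dual (gxx j i)).
- exact: (sub_gen_dual (gtx i j)).
- exact: (sub_gen_dual (gxv j i)).
- by case: (leqP i j) => [/gtv//|/ltnW/gtv H]; exact: (sub_gen_dual H).
- exact: (sub_gen_dual (gyt j i)).
- exact: (sub_gen_dual (gxt j i)).
- by case: (leqP i j) => [/gvt//|/ltnW/gvt H]; exact: (sub_gen_dual H).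
- exact: (sub_gen_dual (gtt j i)).
Qed.
End Subspace.

(** With homogeneity as an eigenvalue equation, stability follows from commutation with [gen]. *)
Lemma AkE k f : Ak k f <-> Eul f = k%:R *: f.
Proof.
split=> [Af|Ef z fz]; first apply/funext => z.
  rewrite EulE scaleE; have [->|/Af ->//] := eqVneq (f z) 0.
  by rewrite !mulr0.
have := congr1 (@^~ z) Ef; rewrite EulE scaleE => /(mulIf fz)/eqP.
by rewrite eqr_nat => /eqP.
Qed.

Lemma HkE k f : Hk k f <-> Eul f = k%:R *: f /\ Lap f = 0.
Proof.
rewrite /Hk AkE LapE; split=> -[-> H]; split=> //.
  by rewrite (_ : lap f = 0) ?scaler0 //; apply/funext => z; exact: H.
move=> z; have := congr1 (@^~ z) H; rewrite scaleE => /eqP.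
by rewrite mulf_eq0 pnatr_eq0 /= => /eqP.
Qed.

Lemma subspace_Eul (c : CC) : subspace (fun f => Eul f = c *: f).
Proof.
split=> [|f g Ef Eg|d f Ef].
- by rewrite -[@pzero n m]/(0 : spoly n m) linear0 scaler0.
- by rewrite paddE EulD Ef Eg scalerDr.
- by rewrite -[pscale d f]/(d *: f) EulZ Ef !scalerA mulrC.
Qed.

Lemma gen_stable_Eul (c : CC) : gen_stable (fun f => Eul f = c *: f).
Proof. by move=> u v f Ef; rewrite Eul_gen Ef linearZ. Qed.

Lemma subspace_Hk k : subspace (@Hk n m k).
Proof.
have [s0 sD sZ] := subspace_Eul k%:R.
split=> [|f g|d f]; rewrite !HkE.
- by split=> //; rewrite -[@pzero n m]/(0 : spoly n m) linear0.
- by move=> [Ef Lf] [Eg Lg]; split; [exact: sD | rewrite paddE LapD Lf Lg addr0].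
- by move=> [Ef Lf]; split; [exact: sZ | rewrite -[pscale d f]/(d *: f) LapZ Lf scaler0].
Qed.

Lemma gen_stable_Hk k : gen_stable (@Hk n m k).
Proof.
move=> u v f; rewrite !HkE => -[Ef Lf]; split; first exact: gen_stable_Eul.
by rewrite Lap_gen Lf linear0.
Qed.

End Stable.

#[local] Arguments mul : simpl never.
#[local] Arguments der : simpl never.
#[local] Arguments sg : simpl never.
#[local] Arguments lam : simpl never.
#[local] Arguments expo : simpl never.
#[local] Arguments dual : simpl never.

(** * Vectors killed by the raising operators, and generation from x^k *)

Section Highest.
Local Open Scope ring_scope.
Variables n m : nat.
Variable i0 : 'I_n.
Implicit Types (f g h : spoly n m) (z : mono n m) (u v w t : var n m).
Implicit Types (W : spoly n m -> Prop) (k : nat).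

Let x : var n m := inl (inl i0).
Let y : var n m := inl (inr i0).
Let rest v := (v != x) && (v != y).

Lemma rest_dual v : rest (dual v) = rest v.
Proof. by rewrite /rest !dual_eq andbC. Qed.

Lemma sum_rest (V : nmodType) (F : var n m -> V) :
  \sum_v F v = F x + F y + \sum_(v | rest v) F v.
Proof. by rewrite (bigD1 x) //= (bigD1 y) //= addrA. Qed.

Lemma sgx v : sg x v = 1. Proof. by rewrite /sg expr0. Qed.
Lemma sgy v : sg y v = 1. Proof. by rewrite /sg expr0. Qed.

Lemma expo_le_deg z : (expo x z + expo y z <= deg z)%N.
Proof. by rewrite deg_expo (bigD1 x) //= (bigD1 y) //= addnA leq_addr. Qed.

(* The line spanned by x^k. *)
Definition xline k f := Eul f = k%:R *: f /\ forall v, v != x -> der v f = 0.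

Lemma xline_expo k f z : xline k f -> f z != 0 ->
  forall v, expo v z = if v == x then k else 0%N.
Proof.
move=> [/AkE Ef df] fz.
have e0 v : v != x -> expo v z = 0%N.
  move=> /df dv; case E: (expo v z) => [//|e].
  have [|z' + _] := der_neq0 fz (v := v); first by rewrite E.
  by rewrite dv zeroE eqxx.
move=> v; case: eqP => [->|/eqP/e0 //].
have := Ef z fz; rewrite deg_expo (bigD1 x) //= big1 ?addn0 //.
Qed.

(** Both are supported on the single monomial x^k. *)
Lemma xline_scale k f h : xline k f -> xline k h -> (exists z, f z != 0) ->
  exists c, h = c *: f.
Proof.
move=> xf xh [z fz]; exists (h z / f z); apply/funext => z'.
have E g : xline k g -> g z' != 0 -> z' = z.
  by move=> xg gz; apply: expo_inj => v; rewrite (xline_expo xg gz) (xline_expo xf fz).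
rewrite scaleE; have [->|zz'] := pselect (z' = z); first by rewrite divfK.
have -> : f z' = 0 by apply/eqP/negPn/negP => /(E _ xf).
by rewrite mulr0; apply/eqP/negPn/negP => /(E _ xh).
Qed.

(** Every term of Delta differentiates by some variable other than x. *)
Lemma xline_Hk k f : xline k f -> Hk k f.
Proof.
move=> [Ef df]; apply/HkE; split=> //; rewrite /Lap big1 // => v _.
case: (eqVneq (dual v) x) => [vx|/df ->]; last by rewrite !linear0.
rewrite derC (df v) ?linear0 ?scaler0 //.
by rewrite -(dualK v) vx.
Qed.

(** Every monomial of a multiple of eta contains both members of some dual pair. *)
Lemma xline_notin_Eta k f g : xline k f -> f = Eta g -> f = 0.
Proof.
move=> xf fg; apply/funext => z; apply/eqP/negPn/negP => fz.
suff : Eta g z = 0 by rewrite -fg => e; rewrite e eqxx in fz.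
rewrite /Eta sumE big1 // => v _; rewrite scaleE; apply/eqP.
rewrite mulf_eq0; apply/orP; right; apply/negPn/negP => /mul_supp[z1 gz1 e1].
have [z2 _ e2] := mul_supp gz1.
have := e1 v; have := e1 (dual v); rewrite e2 !eqxx dual_neq.
rewrite !(xline_expo xf fz); case: (eqVneq v x) => [->|_].
  by rewrite (_ : (dual x == x) = false) //; lia.
by move=> _; lia.
Qed.

Definition one : spoly n m := fun z => (deg z == 0%N)%:R.

Lemma iter_mulx_xline k : xline k (iter k (mul x) one).
Proof.
elim: k => [|k [Ek dk]] /=.
  have A0 : Ak 0 one by move=> z; rewrite /one; case: (deg z =P 0%N) => // _; rewrite eqxx.
  split=> [|v _]; first exact/AkE.
  apply/funext => z; rewrite zeroE; apply/eqP/negPn/negP => /der_supp[z' /A0].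
  by rewrite deg_expo (bigD1 v) //= => + e; rewrite e eqxx; lia.
split=> [|v vx]; first by rewrite Eul_mul Ek linearZ /= -{2}[mul x _]scale1r -scalerDl natr1.
by rewrite der_mul (negPf vx) scale0r add0r dk // linear0 scaler0.
Qed.

Lemma iter_mulx_neq0 k : exists z, iter k (mul x) one z != 0.
Proof.
elim: k => [|k [z fz]] /=.
  exists (Mono [ffun=> 0%N] [ffun=> 0%N] finset.set0 finset.set0).
  rewrite /one /deg /= !cards0 !big1 ?eqxx ?oner_neq0 // => i _; rewrite ffunE //.
by have [//|z' H _] := mul_neq0 (v := x) _ fz; exists z'.
Qed.

Lemma gen_x t f : gen x t f = mul x (der t f) - lam t *: mul (dual t) (der y f).
Proof. by rewrite /gen sgx mulr1 mul1r. Qed.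

Lemma gen_x_eq0 t f : gen x t f = 0 -> mul x (der t f) = lam t *: mul (dual t) (der y f).
Proof. by rewrite gen_x => /eqP; rewrite subr_eq0 => /eqP. Qed.

Lemma mulx_inj f : mul x f = 0 -> f = 0.
Proof.
move=> xf; apply/funext => z; apply/eqP/negPn/negP => fz.
by have [//|z' + _] := mul_neq0 (v := x) _ fz; rewrite xf zeroE eqxx.
Qed.

Lemma deg_step v z z' : (forall w, expo w z = (expo w z' + (w == v))%N) ->
  deg z = (deg z').+1.
Proof.
move=> e; rewrite !deg_expo (eq_bigr _ (fun w _ => e w)) big_split /=.
rewrite -addn1; congr (_ + _)%N.
by rewrite (bigD1 v) //= eqxx big1 // => w /negPf ->.
Qed.

(** The first term trades t for x, the second y for [dual t]; either raises the x-exponent minus the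
    y-exponent by one, stated here without subtraction. *)
Lemma gen_x_supp t f z : rest t -> gen x t f z != 0 -> exists2 z', f z' != 0 &
  (expo x z' + expo y z + 1 = expo x z + expo y z')%N /\ deg z' = deg z.
Proof.
move=> rt; have yx : (y == x) = false by [].
have [tx ty] : (x == t) = false /\ (y == t) = false.
  by case/andP: rt => /negPf tx /negPf ty; rewrite eq_sym tx eq_sym ty.
have [dtx dty] : (x == dual t) = false /\ (y == dual t) = false.
  by move: rt; rewrite -rest_dual => /andP[/negPf tx' /negPf ty']; rewrite eq_sym tx' eq_sym ty'.
rewrite gen_x addE oppE scaleE.
have [->|/mul_supp[z1 /der_supp[z' fz e'] e] _] := eqVneq (mul x (der t f) z) 0; last first.
  exists z' => //; rewrite (deg_step e) (deg_step e').
  by rewrite !e' !e tx ty yx eqxx; split=> //; lia.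
rewrite add0r oppr_eq0 mulf_eq0 negb_or => /andP[_ /mul_supp[z1 /der_supp[z' fz e'] e]].
exists z' => //; rewrite (deg_step e) (deg_step e').
by rewrite !e' !e dtx dty eqxx [x == y]eq_sym yx; split=> //; lia.
Qed.

Lemma exists_singular k W : subspace W -> gen_stable W -> (forall f, W f -> Ak k f) ->
  (exists2 f, W f & f <> 0) ->
  exists f, [/\ W f, f <> 0 & forall t, rest t -> gen x t f = 0].
Proof.
move=> sW gW WA [f Wf f0].
(* [d] is the room left: the exponent differences of g are at least k - d. They start from -k, and
   none can exceed k. *)
suff H d g : W g -> g <> 0 ->
    (forall z, g z != 0 -> (k + expo y z <= d + expo x z)%N) ->
    exists f, [/\ W f, f <> 0 & forall t, rest t -> gen x t f = 0].
  apply: (H (2 * k)%N f) => // z /(WA _ Wf) <-.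
  by have := expo_le_deg z; lia.
elim: d g => [|d IH] g Wg g0 gs;
  have [?|/existsNP[t /not_implyP[rt gt]]] := pselect (forall t, rest t -> gen x t g = 0);
  try by exists g.
  exfalso; apply: gt; apply/funext => z; apply/eqP/negPn/negP.
  move=> /(gen_x_supp rt)[z' gz' [e dz]].
  by have := gs _ gz'; have := WA _ Wg _ gz'; have := expo_le_deg z; lia.
apply: (IH (gen x t g)) => //; first exact: gW.
move=> z /(gen_x_supp rt)[z' gz' [e dz]].
by have := gs _ gz'; lia.
Qed.

Variable i1 : 'I_n.
Hypothesis i01 : i0 != i1.
Let x2 : var n m := inl (inl i1).
Let y2 : var n m := inl (inr i1).
Let x2x : x2 != x.
Proof. by apply: contra i01 => /eqP[->]. Qed.
Let y2y : y2 != y.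
Proof. by apply: contra i01 => /eqP[->]. Qed.

Let rest_x2 : rest x2.
Proof. by rewrite /rest x2x. Qed.
Let rest_y2 : rest y2.
Proof. by rewrite /rest y2y. Qed.

(* An exponent of y exceeding that of x would propagate along
   x d_{y_2} f = x_2 d_y f down to a monomial without x. *)
Lemma singular_expo f z : (forall t, rest t -> gen x t f = 0) -> f z != 0 ->
  (expo y z <= expo x z)%N.
Proof.
move=> sf; have := gen_x_eq0 (sf y2 rest_y2); rewrite scale1r -[dual y2]/x2 => E.
have xx2 : (x == x2) = false by rewrite eq_sym (negPf x2x).
have yy2 : (y == y2) = false by rewrite eq_sym (negPf y2y).
(* Each pass trades one x and one y of the monomial for x_2 and y_2; a monomial with y but without x
   admits no pass. *)
elim: (expo x z) {-2}z (leqnn (expo x z)) => [|a IH] {}z az fz;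
  (case: (posnP (expo y z)) => [->//|y0]);
  have [z1 gz1 e1] := der_neq0 fz y0;
  (have [//|z2 + e2] := mul_neq0 (v := x2) _ gz1; rewrite -E => /mul_supp[z3 + e3]);
  move=> /der_supp[z4 fz4 e4];
  have := e1 x; have := e2 x; have := e3 x; have := e4 x;
  have := e1 y; have := e2 y; have := e3 y; have := e4 y;
  rewrite !eqxx ?xx2 ?yy2 (_ : (y == x2) = false) // (_ : (x == y2) = false) //
    (_ : (x == y) = false) // (_ : (y == x) = false) //.
  by lia.
by move=> *; have := IH z4 _ fz4; lia.
Qed.

Lemma sum_sg_rest : \sum_(v | rest v) sg v v = 2 * (sdim n m - 1).
Proof.
have E := sum_sg n m; rewrite sum_rest sgx sgy in E.
have -> : 2 * (sdim n m - 1) = 2 * sdim n m - (1 + 1) by ring.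
by rewrite -E [RHS]addrC addKr.
Qed.

(** [regular] rules out the eigenvalues that a monomial of d_y f could have. Once d_y f = 0, the
    singular equations read x d_t f = 0, and multiplication by x is injective. *)
Lemma singular_xline k f : Hk k f -> (forall t, rest t -> gen x t f = 0) ->
  (forall d, (d.+2 <= k)%N -> k%:R + d%:R + 2 * (sdim n m - 1) != 0) ->
  xline k f.
Proof.
move=> /HkE[Ef Lf] sf regular; have Af := Ef; move/AkE in Af.
set g := der y f.
have Eg : Eul g = (k%:R - 1) *: g by rewrite Eul_der Ef linearZ /= scalerBl scale1r.
(* Apply d_v to the singular equation of [dual v]. *)
have rel v : rest v -> lam v *: mul x (der v (der (dual v) f)) =
    sg v v *: g + mul v (der v g).
  move=> rv; have : der v (mul x (der (dual v) f)) = der v (lam (dual v) *: mul v g).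
    by rewrite gen_x_eq0 ?dualK //; apply: sf; rewrite rest_dual.
  rewrite der_mul (negPf (proj1 (andP rv))) scale0r add0r sgC sgx scale1r => ->.
  rewrite derZr der_mul eqxx scale1r !scalerA lam_dual mulrCA lamK mulr1.
  by rewrite scalerDr scalerA sgK scale1r.
have sgr := sum_sg_rest.
(* Multiply Delta f = 0 by x, substitute [rel], and remove the transversal sum by Euler's formula
   for g, of degree k - 1. *)
have key : mul x (der x g) - mul y (der y g) + (k%:R - 1 + 2 * (sdim n m - 1)) *: g = 0.
  have : mul x (Lap f) = 0 by rewrite Lf linear0.
  rewrite /Lap sum_rest !mulDr linear_sum /= !mulZr.
  rewrite (eq_bigr (fun v => sg v v *: g + mul v (der v g))); last first.
    by move=> v rv; rewrite mulZr rel.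
  have := Eg; rewrite {1}/Eul sum_rest big_split /= -scaler_suml sgr.
  rewrite -[dual x]/y -[dual y]/x !scale1r (derC y x) sgy scale1r -/g.
  move: (\sum_(v | _) _) (mul x _) (mul y _) => S A B EA <-.
  have -> : S = (k%:R - 1) *: g - (A + B) by rewrite -EA [RHS]addrC addKr.
  rewrite scalerDl.
  by apply/funext => z; rewrite !(addE, oppE, scaleE); ring.
have g0 : g = 0.
  apply/funext => z; apply/eqP/negPn/negP => gz.
  have [z' fz' e'] := der_supp gz.
  have le := singular_expo sf fz'; have := expo_le_deg z'; rewrite (Af _ fz') => kle.
  have := congr1 (@^~ z) key; rewrite !addE oppE scaleE !mul_der => /eqP.
  rewrite -mulrBl -mulrDl mulf_eq0 (negPf gz) orbF => /eqP e0.
  have := e' x; have := e' y; rewrite eqxx (_ : (x == y) = false) // => ey ex.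
  (* The eigenvalue of x d_x - y d_y at z is d + 1. As z times y occurs in f, the y-exponent of z is
     below its x-exponent, and degree k gives d + 2 <= k. *)
  have /negP := regular (expo x z - expo y z).-1%N ltac:(lia); apply.
  apply/eqP; rewrite -[RHS]e0.
  have -> : (expo x z)%:R = (expo x z - expo y z).-1%:R + 1 + (expo y z)%:R :> CC.
    by rewrite -[X in _ + X + _]/(1%:R) -!natrD; congr _%:R; lia.
  by ring.
have dt t : rest t -> der t f = 0.
  by move=> rt; apply: mulx_inj; rewrite gen_x_eq0 ?sf // -/g g0 linear0 scaler0.
split=> // v vx; case: (eqVneq v y) => [->//|vy].
by apply: dt; rewrite /rest vx.
Qed.

(** * Powers of x and y times transversal elements *)

Definition mulp v a f : spoly n m := iter a (mul v) f.

Lemma mulp_linear v a : linear (mulp v a).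
Proof. by move=> c f g; elim: a => //= a ->; rewrite mulDr mulZr. Qed.
HB.instance Definition _ v a := GRing.isLinear.Build CC (spoly n m) (spoly n m) _
  (mulp v a) (mulp_linear v a).
Lemma mulpS v a f : mulp v a.+1 f = mul v (mulp v a f). Proof. by []. Qed.
Lemma mulpD v a f g : mulp v a (f + g) = mulp v a f + mulp v a g.
Proof. exact: linearD. Qed.
Lemma mulpB v a f g : mulp v a (f - g) = mulp v a f - mulp v a g.
Proof. exact: linearB. Qed.
Lemma mulpZ v a c f : mulp v a (c *: f) = c *: mulp v a f.
Proof. exact: linearZ. Qed.

Lemma Eul_mulp v a f (c : CC) :
  Eul f = c *: f -> Eul (mulp v a f) = (a%:R + c) *: mulp v a f.
Proof.
move=> Ef; elim: a => [|a IH] /=; first by rewrite add0r.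
rewrite Eul_mul IH mulZr -{2}[mul v _]scale1r -scalerDl -natr1.
by congr (_ *: _); ring.
Qed.

Lemma Eta_mulp v a f : Eta (mulp v a f) = mulp v a (Eta f).
Proof. by elim: a => //= a <-; rewrite Eta_mul. Qed.

Lemma mul_mulp u v a f : par v = false -> mul u (mulp v a f) = mulp v a (mul u f).
Proof.
move=> pv; elim: a => //= a <-; rewrite mulC /sg pv andbF expr0 scale1r //.
Qed.

Lemma der_mulp u v a f : par v = false -> u != v ->
  der u (mulp v a f) = mulp v a (der u f).
Proof.
move=> pv /negPf uv; elim: a => //= a <-.
by rewrite der_mul uv scale0r add0r /sg pv andbF expr0 scale1r.
Qed.

Lemma derx_mulp a f : der x f = 0 -> der x (mulp x a.+1 f) = a.+1%:R *: mulp x a f.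
Proof.
move=> xf; elim: a => [|a IH].
  by rewrite /= der_mul eqxx xf linear0 scaler0 addr0.
rewrite mulpS der_mul eqxx sgx !scale1r IH mulZr -mulpS.
by rewrite -{1}[mulp x a.+1 f]scale1r -scalerDl nat1r.
Qed.

(* Homogeneous elements of degree l in the transversal variables only. *)
Definition slice l g := [/\ Eul g = l%:R *: g, der x g = 0 & der y g = 0].

(** Twice the transversal part eta' of eta. *)
Definition Eta' f : spoly n m := \sum_(v | rest v) lam v *: mul v (mul (dual v) f).

(** Solves Eta = 2 x y + Eta' for x y, so that modulo multiples of eta the product x y turns into
    transversal pairs. *)
Lemma mulyx f : mul y (mul x f) = 2^-1 *: (Eta f - Eta' f).
Proof.
rewrite /Eta sum_rest -/(Eta' f) addrK -[dual x]/y -[dual y]/x !scale1r (mulC x) sgx scale1r.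
by rewrite -mulr2n -scaler_nat scalerA mulVf ?scale1r // pnatr_eq0.
Qed.

Lemma mulxy f : mul x (mul y f) = 2^-1 *: (Eta f - Eta' f).
Proof. by rewrite mulC sgx scale1r mulyx. Qed.

Lemma slice_mul l t g : rest t -> slice l g -> slice l.+1 (mul t g).
Proof.
move=> /andP[tx ty] [Eg xg yg]; split.
- by rewrite Eul_mul Eg mulZr -{2}[mul t g]scale1r -scalerDl natr1.
- by rewrite der_mul eq_sym (negPf tx) scale0r add0r xg linear0 scaler0.
- by rewrite der_mul eq_sym (negPf ty) scale0r add0r yg linear0 scaler0.
Qed.

Lemma slice_der l t g : slice l.+1 g -> slice l (der t g).
Proof.
move=> [Eg xg yg]; split.
- by rewrite Eul_der Eg derZr -{2}[der t g]scale1r -scalerBl -natr1 addrK.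
- by rewrite derC xg linear0 scaler0.
- by rewrite derC yg linear0 scaler0.
Qed.

Lemma subspace_slice l : subspace (slice l).
Proof.
have [s0 sD sZ] := @subspace_Eul n m l%:R; split.
- by split=> //; rewrite -[@pzero n m]/(0 : spoly n m) linear0.
- move=> f g [Ef xf yf] [Eg xg yg]; split; first exact: sD.
    by rewrite paddE derDr xf xg addr0.
  by rewrite paddE derDr yf yg addr0.
- move=> c f [Ef xf yf]; split; first exact: sZ.
    by rewrite -[pscale c f]/(c *: f) derZr xf scaler0.
  by rewrite -[pscale c f]/(c *: f) derZr yf scaler0.
Qed.

Lemma slice_Eta' l g : slice l g -> slice l.+2 (Eta' g).
Proof.
move=> sg; apply: (sub_sum (subspace_slice _)) => v rv.
apply: (subZ (subspace_slice _)); apply: slice_mul => //.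
by apply: slice_mul => //; rewrite rest_dual.
Qed.

Lemma slice_Lap l g : slice l.+2 g -> slice l (Lap g).
Proof.
move=> sg; apply: (sub_sum (subspace_slice _)) => v _.
by apply: (subZ (subspace_slice _)); do 2 apply: slice_der.
Qed.

Lemma der_Eul0 v g : Eul g = 0%:R *: g -> der v g = 0.
Proof.
move=> /AkE A0; apply/funext => z; apply/eqP/negPn/negP => /der_supp[z' /A0 + e].
by rewrite (deg_step (z := z') (z' := z) (v := v)).
Qed.

Lemma gen_tx t f : gen t x f = mul t (der x f) - lam (dual t) *: mul y (der (dual t) f).
Proof. by rewrite /gen sgC sgx !mulr1. Qed.

(* [mul v (dscale v f)] is an antiderivative of f for an even variable v. *)
Definition dscale v f : spoly n m := fun z => (expo v z).+1%:R^-1 * f z.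

Lemma der0P v f : der v f = 0 <-> (forall z, f z != 0 -> expo v z = 0%N).
Proof.
split=> [df z fz|H].
  case E: (expo v z) => [//|e]; have [|z' + _] := der_neq0 fz (v := v).
    by rewrite E.
  by rewrite df zeroE eqxx.
apply/funext => z; apply/eqP/negPn/negP => /der_supp[z' /H + e].
by rewrite e eqxx addn1.
Qed.

Lemma dscale_supp v f z : dscale v f z != 0 -> f z != 0.
Proof. by rewrite /dscale mulf_eq0 negb_or => /andP[]. Qed.

Lemma der_mul_dscale v f : par v = false -> der v (mul v (dscale v f)) = f.
Proof.
move=> pv; rewrite der_mul eqxx scale1r /sg pv expr0 scale1r; apply/funext => z.
rewrite addE mul_der /dscale -[X in X + _]mul1r -mulrDl nat1r mulrA divff ?mul1r //.
by rewrite pnatr_eq0.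
Qed.

Lemma Ak_der k v f : Ak k.+1 f -> Ak k (der v f).
Proof.
by move=> Af z /der_supp[z' /Af e /deg_step]; rewrite e => -[].
Qed.

Lemma Ak_dscale k v f : Ak k f -> Ak k (dscale v f).
Proof. by move=> Af z /dscale_supp/Af. Qed.

Lemma Ak_mul k v f : Ak k f -> Ak k.+1 (mul v f).
Proof. by move=> Af z /mul_supp[z' /Af <- /deg_step]. Qed.

Lemma der_dscale0 v w f : der v f = 0 -> der v (dscale w f) = 0.
Proof. by rewrite !der0P => H z /dscale_supp/H. Qed.

Lemma der_split v f : par v = false ->
  der v (f - mul v (dscale v (der v f))) = 0.
Proof. by move=> pv; rewrite derBr der_mul_dscale // subrr. Qed.

Lemma Eta'_mulp v a f : par v = false -> Eta' (mulp v a f) = mulp v a (Eta' f).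
Proof.
move=> pv; rewrite /Eta' linear_sum; apply: eq_bigr => w _.
by rewrite /= mulpZ !mul_mulp.
Qed.

(** * Reaching all of A_k from x^k modulo the image of eta *)

Section Generate.
(** [N] stands for W + eta A_{k-2}, with W a submodule containing x^k. The degree k - 2 is taken in
    the complex numbers, so that for k < 2 it is negative and forces f = 0 in [EtaN]. *)
Variables (k : nat) (N : spoly n m -> Prop).
Hypothesis sN : subspace N.
Hypothesis gN : gen_stable N.
Hypothesis lineN : forall f, xline k f -> N f.
Hypothesis EtaN : forall f, Eul f = (k%:R - 2) *: f -> N (Eta f).
Hypothesis regular : forall d, (d.+2 <= k)%N -> k%:R + d%:R + 2 * (sdim n m - 1) != 0.

(** This is [gen t x] applied to x^(a+1) g with x^a factored out; the remaining x stays next to y,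
    ready for [mulyx]. *)
Lemma lower_x l a t g : (a.+1 + l)%N = k ->
  (forall g, slice l g -> N (mulp x a.+1 g)) -> rest t -> slice l g ->
  N (mulp x a (a.+1%:R *: mul t g - lam (dual t) *: mul y (mul x (der (dual t) g)))).
Proof.
move=> ak IH rt sg; have [Eg xg yg] := sg; have := gN t x (IH _ sg).
have dx : dual t != x by move: rt; rewrite -rest_dual => /andP[].
rewrite gen_tx derx_mulp // der_mulp // mulZr mulpB !mulpZ mul_mulp //.
by rewrite mulpS !mul_mulp.
Qed.

Lemma EtaN_mulp a l h : (a + l).+2 = k -> Eul h = l%:R *: h -> N (mulp x a (Eta h)).
Proof.
move=> ak Eh; rewrite -Eta_mulp; apply: EtaN; rewrite (Eul_mulp _ _ Eh) -ak.
by congr (_ *: _); rewrite -!natr1 natrD; ring.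
Qed.

(* Apply the lowering operators to x^(a+1) t' q and sum over t: the two terms
   are both multiples of x^a eta' q modulo the image of eta. *)
Lemma mulp_Eta' l a q : (a + l).+2 = k ->
  (forall g, slice l.+1 g -> N (mulp x a.+1 g)) -> slice l q -> N (mulp x a (Eta' q)).
Proof.
move=> ak IH sq; have [Eq xq yq] := sq.
pose s : CC := 2 * (sdim n m - 1) + l%:R.
have sgr : \sum_(v | rest v) sg v v = 2 * (sdim n m - 1) by exact: sum_sg_rest.
have Er : \sum_(v | rest v) mul v (der v q) = l%:R *: q.
  by rewrite -Eq /Eul sum_rest xq yq !linear0 !add0r.
have D : \sum_(t | rest t) (sg t t *: q + mul (dual t) (der (dual t) q)) = s *: q.
  rewrite big_split /= -scaler_suml sgr /s scalerDl -Er; congr (_ + _).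
  rewrite [RHS](reindex_inj (inv_inj (@dualK n m))) /=.
  by apply: eq_bigl => t; rewrite rest_dual.
have : N (mulp x a (a.+1%:R *: Eta' q - s *: mul y (mul x q))).
  have -> : mulp x a (a.+1%:R *: Eta' q - s *: mul y (mul x q)) =
      \sum_(t | rest t) mulp x a (a.+1%:R *: mul t (lam t *: mul (dual t) q)
        - lam (dual t) *: mul y (mul x (der (dual t) (lam t *: mul (dual t) q)))).
    rewrite -linear_sum; congr mulp; rewrite sumrB; congr (_ - _).
      by rewrite /Eta' scaler_sumr; apply: eq_bigr => t _; rewrite mulZr.
    rewrite -!mulZr -D !linear_sum; apply: eq_bigr => t _.
    rewrite derZr der_mul eqxx scale1r !mulZr scalerA lam_dual -mulrA lamK mulr1.
    by rewrite -(mulZr y) -(mulZr x) scalerDr scalerA sg_dual sg_dualr sgK scale1r.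
  apply: (sub_sum sN) => t rt; apply: (lower_x (l := l.+1)) => //; first by lia.
  apply: (subZ (subspace_slice _)); apply: slice_mul => //.
  by rewrite rest_dual.
rewrite mulyx => H.
(* After [mulyx] this is the coefficient of [Eta' q]; its double is k + a + 2 (sdim - 1), nonzero by
   [regular]. *)
have c0 : a.+1%:R + s / 2 != 0.
  apply/negP => /eqP e0; have /negP := @regular a ltac:(lia); apply; apply/eqP.
  have -> : k%:R = a%:R + l%:R + 2 :> CC by rewrite -ak -!natr1 natrD; ring.
  rewrite -[RHS](mulr0 2) -e0 /s -natr1.
  by field.
apply: (subZ_inv sN c0).
apply: (subD_inv sN (g := (- (s / 2)) *: mulp x a (Eta q))).
  by apply: (subZ sN); exact: EtaN_mulp Eq.
move: H; congr N; rewrite -!mulpZ -mulpD; congr mulp.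
by apply/funext => z; rewrite !(addE, oppE, scaleE); field.
Qed.

(* Summing the lowering operators over x^(a+1) d_t g yields x^a g by Euler's
   formula, up to a term x^a eta' (Delta g). *)
Lemma mulp_slice l g : (l <= k)%N -> slice l g -> N (mulp x (k - l) g).
Proof.
elim: l g => [|l IH] g lk sg; have [Eg xg yg] := sg.
  rewrite subn0; apply: lineN; split; first by rewrite (Eul_mulp _ _ Eg) addr0.
  by move=> v vx; rewrite der_mulp // der_Eul0 // linear0.
have [a ak] : exists a, (a.+1 + l)%N = k by exists (k - l.+1)%N; lia.
rewrite (_ : (k - l.+1)%N = a); last by lia.
have {}IH f : slice l f -> N (mulp x a.+1 f).
  by move=> /IH; rewrite (_ : (k - l)%N = a.+1); [apply|]; lia.
have Er : \sum_(v | rest v) mul v (der v g) = l.+1%:R *: g.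
  by rewrite -Eg /Eul sum_rest xg yg !linear0 !add0r.
have Lr : \sum_(t | rest t) lam (dual t) *: der (dual t) (der t g) = Lap g.
  rewrite /Lap sum_rest -[dual x]/y -[dual y]/x xg yg !linear0 !add0r.
  rewrite [RHS](reindex_inj (inv_inj (@dualK n m))) /=.
  by apply: eq_big => t; rewrite ?rest_dual ?dualK.
have : N (mulp x a ((a.+1%:R * l.+1%:R) *: g - mul y (mul x (Lap g)))).
  have -> : mulp x a ((a.+1%:R * l.+1%:R) *: g - mul y (mul x (Lap g))) =
      \sum_(t | rest t) mulp x a (a.+1%:R *: mul t (der t g)
        - lam (dual t) *: mul y (mul x (der (dual t) (der t g)))).
    rewrite -linear_sum; congr mulp; rewrite sumrB; congr (_ - _).
      by rewrite -scalerA -Er scaler_sumr.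
    by rewrite -Lr !linear_sum; apply: eq_bigr => t _; rewrite /= !mulZr.
  apply: (sub_sum sN) => t rt; apply: (lower_x (l := l)) => //.
  exact: slice_der.
rewrite mulyx => H.
have c0 : a.+1%:R * l.+1%:R != 0 :> CC by rewrite -natrM pnatr_eq0.
apply: (subZ_inv sN c0); move: H; rewrite mulpB mulpZ => H.
apply: (subD_inv sN _ H); apply: (subN sN); rewrite mulpZ; apply: (subZ sN).
(* A transversal g of degree 1 has Delta g = 0 and needs no correction; from degree 2 on,
   [mulp_Eta'] applies to Delta g. *)
rewrite mulpB; case: l => [|l] in lk sg Eg ak IH Er H c0 *.
  have -> : Lap g = 0.
    rewrite -Lr big1 // => t _; rewrite (@der_Eul0 _ (der t g)) ?scaler0 //.
    by have [] := slice_der t sg.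
  have -> : Eta' 0 = 0 by apply: big1 => v _; rewrite !linear0.
  rewrite (_ : Eta 0 = 0); last exact: linear0.
  by rewrite subrr; exact: sub0 sN.
have sq := slice_Lap sg; have [Eq _ _] := sq.
apply: (subB sN); first by apply: EtaN_mulp Eq; lia.
by apply: mulp_Eta' sq => //; lia.
Qed.

(** To gain a factor y, apply [gen y2 x] to y^c f with f an antiderivative of g in x_2: as y^c f is
    free of x, only - y^(c+1) g remains. *)
Lemma mulp_y_slice c l g : (c + l)%N = k -> slice l g -> N (mulp y c g).
Proof.
elim: c l g => [|c IH] l g ck sg.
  by have := @mulp_slice l g; rewrite -ck add0n subnn; apply.
have [/AkE Ag xg yg] := sg.
pose f := mul x2 (dscale x2 g).
have sf : slice l.+1 f.
  apply: slice_mul => //; split; [|exact: der_dscale0|exact: der_dscale0].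
  by apply/AkE; exact: Ak_dscale.
have [_ xf _] := sf.
have ck' : (c + l.+1)%N = k by lia.
have := gN y2 x (IH _ _ ck' sf); rewrite gen_tx -[dual y2]/x2.
rewrite !der_mulp //.
rewrite xf !linear0 add0r der_mul_dscale // scale1r => /(subN sN).
by rewrite opprK.
Qed.

(** Modulo the image of eta, [mulxy] lowers a and c by one and raises the transversal degree by two,
    until a or c is 0. *)
Lemma mulp_xy_slice a c l g : (a + c + l)%N = k -> slice l g ->
  N (mulp x a (mulp y c g)).
Proof.
elim: a c l g => [|a IH] c l g ck sg; first exact: mulp_y_slice ck sg.
case: c => [|c] in ck *.
  have := @mulp_slice l g; rewrite (_ : (k - l)%N = a.+1); last by lia.
  by apply => //; lia.
rewrite [mulp x _ _]iterSr -/(mulp x a _) mulpS mulxy mulpZ mulpB.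
apply: (subZ sN); apply: (subB sN); last first.
  by rewrite Eta'_mulp //; apply: (IH _ l.+2); [lia | exact: slice_Eta'].
have [Eg _ _] := sg; rewrite -Eta_mulp; apply: EtaN.
rewrite (Eul_mulp _ _ (Eul_mulp _ _ Eg)) -ck; congr (_ *: _).
by rewrite !natrD -!natr1; ring.
Qed.

(** Multiples of x and of y are split off repeatedly; j is the degree of the factor still to be
    split. *)
Lemma generate_Ak f : Ak k f -> N f.
Proof.
suff H j a c g : (a + c + j)%N = k -> Ak j g -> N (mulp x a (mulp y c g)).
  by move=> Af; exact: (H k 0%N 0%N).
elim: j a c g => [|j IH] a c g ak Ag.
  apply: (mulp_xy_slice ak); have /AkE Eg := Ag.
  by split=> //; exact: der_Eul0.
(* This gives g = g1 + y gy + x gx with g1 transversal. *)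
pose gx := dscale x (der x g); pose g0 := g - mul x gx.
pose gy := dscale y (der y g0); pose g1 := g0 - mul y gy.
have Agx : Ak j gx by apply: Ak_dscale; exact: Ak_der.
have Ag0 : Ak j.+1 g0.
  have /AkE e1 := Ag; have /AkE e2 := @Ak_mul _ x _ Agx; apply/AkE.
  by rewrite /g0 EulB e1 e2 scalerBr.
have Agy : Ak j gy by apply: Ak_dscale; exact: Ak_der.
have Ag1 : Ak j.+1 g1.
  have /AkE e1 := Ag0; have /AkE e2 := @Ak_mul _ y _ Agy; apply/AkE.
  by rewrite /g1 EulB e1 e2 [RHS]scalerBr.
have -> : g = g1 + mul y gy + mul x gx by rewrite /g1 /g0 !subrK.
have x0 : der x g0 = 0 by exact: der_split.
have x1 : der x g1 = 0.
  rewrite /g1 derBr x0 sub0r der_mul scale0r add0r sgx scale1r.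
  by rewrite der_dscale0 ?linear0 ?oppr0 // derC x0 !linear0.
have y1 : der y g1 = 0 by exact: der_split.
move/AkE: Ag1; clearbody g1 gy gx => Eg1.
rewrite !mulpD; apply: (subD sN); first apply: (subD sN).
- exact: (mulp_xy_slice ak).
- by rewrite -(mul_mulp y) // -mulpS; apply: IH => //; lia.
- by rewrite -!mul_mulp // -mulpS; apply: IH => //; lia.
Qed.

End Generate.
End Highest.

(** * Powers of eta applied to harmonic elements *)

Section Eta_powers.
Local Open Scope ring_scope.
Variables n m : nat.
Implicit Types (f g h : spoly n m) (W : spoly n m -> Prop) (b k l : nat).

Definition etan b f : spoly n m := iter b (@Eta n m) f.

Lemma etan_linear b : linear (etan b).
Proof. by move=> c f g; elim: b => //= b ->; rewrite EtaD EtaZ. Qed.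
HB.instance Definition _ b := GRing.isLinear.Build CC (spoly n m) (spoly n m) _
  (etan b) (etan_linear b).
Lemma etanS b f : etan b.+1 f = Eta (etan b f). Proof. by []. Qed.
Lemma etanD b f g : etan b (f + g) = etan b f + etan b g.
Proof. exact: linearD. Qed.
Lemma etanZ b c f : etan b (c *: f) = c *: etan b f.
Proof. exact: linearZ. Qed.
Lemma etan0 b : etan b 0 = 0.
Proof. exact: linear0. Qed.

Lemma etan_gen u v b f : gen u v (etan b f) = etan b (gen u v f).
Proof. by elim: b => //= b IH; rewrite Eta_gen IH. Qed.

Lemma Eul_Eta f : Eul (Eta f) = Eta (Eul f) + 2 *: Eta f.
Proof.
rewrite /Eta linear_sum scaler_sumr -big_split; apply: eq_bigr => v _ /=.
by rewrite EulZ !Eul_mul mulDr !scalerDr -addrA scaler_nat mulr2n.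
Qed.

Lemma Eul_etan b f (c : CC) :
  Eul f = c *: f -> Eul (etan b f) = (c + (2 * b)%:R) *: etan b f.
Proof.
move=> Ef; elim: b => [|b IH] /=; first by rewrite addr0.
rewrite Eul_Eta IH EtaZ -scalerDl mulnS natrD.
by congr (_ *: _); ring.
Qed.

(** Iterates [Lap_Eta]: the weights l + 2 i + sdim for i = 0, ..., b sum to (b + 1) (l + b +
    sdim). *)
Lemma Lap_etan b l h : Hk l h ->
  Lap (etan b.+1 h) = (4 * b.+1%:R * (l%:R + b%:R + sdim n m)) *: etan b h.
Proof.
move=> /HkE[Eh Lh]; elim: b => [|b IH]; rewrite etanS Lap_Eta.
  by rewrite Lh linear0 add0r Eh -scalerDl scalerA; congr (_ *: _); ring.
rewrite IH EtaZ -etanS (Eul_etan _ Eh) -!scalerDl scalerA -scalerDl.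
by congr (_ *: _); rewrite mulnS !natrD -!natr1; ring.
Qed.

(** [Eta] is twice [eta]; the power of 2 is absorbed into the harmonic factor. *)
Lemma etaHE i j f : etaH i j f <-> exists2 h, Hk j h & f = etan i h.
Proof.
have E h : iter i (@eta n m) h = (2 ^- i) *: etan i h.
  elim: (i) => [|b IH] /=; first by rewrite expr0 invr1 scale1r.
  have -> f' : eta f' = 2^-1 *: Eta f'.
    by rewrite EtaE scalerA mulVf ?scale1r // pnatr_eq0.
  by rewrite IH EtaZ scalerA exprS invfM.
split=> [[h [hh fh]]|[h hh ->]].
  exists (2 ^- i *: h); first exact: (subZ (subspace_Hk n m _)).
  by rewrite etanZ -E; apply/funext.
exists (2 ^+ i *: h); split; first exact: (subZ (subspace_Hk n m _)).
by move=> z; rewrite E etanZ scalerA mulVf ?scale1r // expf_neq0 // pnatr_eq0.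
Qed.

Lemma subspace_etaH i j : subspace (@etaH n m i j).
Proof.
have sH := subspace_Hk n m j; split.
- by apply/etaHE; exists 0; [exact: (sub0 sH) | rewrite etan0].
- move=> f g /etaHE[h hh ->] /etaHE[h' hh' ->]; apply/etaHE.
  by exists (h + h'); [exact: (subD sH) | rewrite etanD].
- move=> c f /etaHE[h hh ->]; apply/etaHE.
  by exists (c *: h); [exact: (subZ sH) | rewrite etanZ].
Qed.

Lemma gen_stable_etaH i j : gen_stable (@etaH n m i j).
Proof.
move=> u v f /etaHE[h hh ->]; apply/etaHE.
by exists (gen u v h); [exact: gen_stable_Hk | rewrite etan_gen].
Qed.

Lemma etaH_Ak i k f : (2 * i <= k)%N -> etaH i (k - 2 * i) f -> Ak k f.
Proof.
move=> ik /etaHE[h /HkE[Eh _] ->]; apply/AkE; rewrite (Eul_etan _ Eh).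
by rewrite -natrD subnK.
Qed.

Lemma Eul_neg f (k : nat) : (k < 2)%N -> Eul f = (k%:R - 2) *: f -> f = 0.
Proof.
move=> k2 Ef; apply/funext => z; apply/eqP/negPn/negP => fz.
have := congr1 (@^~ z) Ef; rewrite EulE scaleE => /(mulIf fz)/eqP.
rewrite eq_sym subr_eq -natrD eqr_nat => /eqP; lia.
Qed.

(** Delta kills the term i = 0 and lowers the other powers of eta by one with nonzero coefficients
    [c], leaving a shorter relation in degree k - 2. The bound on 2 b keeps k - 2 i from
    truncating. *)
Lemma etan_eq0 k b (H : nat -> spoly n m) : (k + n <= m.+1)%N -> (2 * b <= k.+2)%N ->
  (forall i, (i < b)%N -> Hk (k - 2 * i) (H i)) ->
  \sum_(i < b) etan i (H i) = 0 -> forall i, (i < b)%N -> H i = 0.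
Proof.
elim: b k H => [//|b IH] k H kn bk HH S0.
pose c i : CC := 4 * i.+1%:R * ((k - 2 * i.+1)%:R + i%:R + sdim n m).
have c0 i : (i < b)%N -> c i != 0.
  move=> ib; rewrite !mulf_neq0 ?pnatr_eq0 // addrA -natrD subr_eq0.
  by rewrite -natrD eqr_nat; lia.
have : \sum_(i < b) etan i (c i *: H i.+1) = 0.
  have : Lap (\sum_(i < b.+1) etan i (H i)) = 0 by rewrite S0 linear0.
  rewrite big_ord_recl LapD linear_sum /=; have /HkE[_ ->] := HH 0%N isT.
  rewrite add0r => e0; rewrite -[RHS]e0; apply: eq_bigr => i _.
  by rewrite etanZ (Lap_etan _ (HH i.+1 _)) // ltnS.
move=> S1; have {}IH := IH (k - 2)%N (fun i => c i *: H i.+1) _ _ _ S1.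
have HS i : (i < b)%N -> H i.+1 = 0.
  move=> ib; have : c i *: H i.+1 = 0.
    apply: (IH _ _ _ i ib); [lia | lia |].
    move=> j jb; rewrite -subnDA -mulnS; apply: (subZ (subspace_Hk n m _)).
    exact: HH.
  by move/eqP; rewrite scaler_eq0 (negPf (c0 _ ib)) => /eqP.
case=> [_|i ib]; last exact: HS.
move: S0; rewrite big_ord_recl big1 ?addr0 // => i _.
by rewrite HS ?etan0.
Qed.

(** A zero would mean k + d = 2 (m + 1 - n) with 0 <= d <= k - 2, hence m + 1 - n < k <= 2 (m + 1 -
    n). *)
Lemma regular_weights k : (k + n <= m.+1)%N \/ (2 * m.+1 < k + 2 * n)%N ->
  forall d, (d.+2 <= k)%N -> k%:R + d%:R + 2 * (sdim n m - 1) != 0.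
Proof.
move=> H d dk; apply/negP => /eqP e.
have : (k + d + 2 * n)%:R = (2 * m.+1)%:R :> CC.
  by apply/eqP; rewrite -subr_eq0 -e !natrD -natr1 /sdim; apply/eqP; ring.
by move/eqP; rewrite eqr_nat => /eqP; lia.
Qed.

End Eta_powers.

(** * The submodules eta^i H_l, reducibility, irreducibility and the decomposition *)

Section Irreducible.
Local Open Scope ring_scope.
Variables n m : nat.
Variable i0 : 'I_n.
Implicit Types (f g h : spoly n m) (W : spoly n m -> Prop) (b k l : nat).

Let xpow k : spoly n m := iter k (mul (inl (inl i0))) (@one n m).

Let xpowP k : xline i0 k (xpow k) := iter_mulx_xline m i0 k.

Let xpow_neq0 k : xpow k <> 0.
Proof.
by move=> e; have [z] := iter_mulx_neq0 m i0 k; rewrite -/(xpow k) e eqxx.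
Qed.

Lemma exists_neq0 f : f <> 0 -> exists z, f z != 0.
Proof.
move=> f0; apply: contrapT => /forallNP H; apply: f0; apply/funext => z.
by apply/eqP/negPn/negP; exact: H.
Qed.

(** As d_y h = 0 and [d_y, Eta] = 2 x, differentiating by y lowers the power of eta by one, up to a
    positive factor and the injective multiplication by x. *)
Lemma etan_inj0 b k h : xline i0 k h -> etan b h = 0 -> h = 0.
Proof.
move=> xh; elim: b => [//|b IH] e; apply: IH.
have dy : der (inl (inr i0)) h = 0 by case: xh => _; apply.
have D : der (inl (inr i0)) (etan b.+1 h) = (2 * b.+1%:R) *: mul (inl (inl i0)) (etan b h).
  elim: (b) => [|b' IHb]; rewrite etanS der_Eta.
    by rewrite dy linear0 add0r -[lam _]/(1 : CC).
  rewrite IHb EtaZ Eta_mul -etanS -scalerDl -[lam _]/(1 : CC); congr (_ *: _).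
  by rewrite mulr1 -[in RHS]natr1; ring.
apply: (@mulx_inj n m i0); move: D; rewrite e linear0 => /esym/eqP.
by rewrite scaler_eq0 mulf_eq0 !pnatr_eq0 /= => /eqP.
Qed.

(** A submodule W pulls back along eta^i to a submodule of H_l, which is zero or everything; the
    image is nonzero since it contains eta^i x^l. *)
Lemma irreducible_etaH i l : irreducible (@Hk n m l) -> irreducible (@etaH n m i l).
Proof.
move=> [sH oH _ iH]; split; first exact: subspace_etaH.
- by apply: gen_stable_osp; exact: gen_stable_etaH.
- exists (etan i (xpow l)); split.
    by apply/etaHE; exists (xpow l) => //; exact: xline_Hk (xpowP l).
  by apply: exists_neq0 => /(etan_inj0 (xpowP l)); exact: xpow_neq0.
move=> W sW /(osp_gen_stable sW) gW WH.
case: (iH (fun h => Hk l h /\ W (etan i h))).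
- split.
  + by split; [exact: (sub0 sH) | rewrite -[@pzero n m]/(0 : spoly n m) etan0; exact: (sub0 sW)].
  + move=> f g [Hf Wf] [Hg Wg]; split; first exact: (subD sH).
    by rewrite paddE etanD; exact: (subD sW).
  + move=> c f [Hf Wf]; split; first exact: (subZ sH).
    by rewrite -[pscale c f]/(c *: f) etanZ; exact: (subZ sW).
- apply: gen_stable_osp => u v f [Hf Wf]; split; first exact: gen_stable_Hk.
  by rewrite -etan_gen; exact: gW.
- by move=> f [].
- move=> Z; left=> f Wf z; have /etaHE[h Hh fh] := WH _ Wf.
  have -> : f = 0; last by [].
  rewrite fh (_ : h = 0) ?etan0 //; apply/funext => z'.
  by apply: Z; rewrite -fh.
- by move=> H; right=> f /etaHE[h Hh ->]; have [] := H _ Hh.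
Qed.

(** The relation between l and b annihilates the coefficient in [Lap_etan], so eta^b H_l is
    harmonic. It contains the nonzero eta^b x^l but not x^(l+2b). *)
Lemma reducible_Hk b l : ((l + b) + n = m.+1)%N -> (0 < b)%N ->
  ~ irreducible (@Hk n m (l + 2 * b)).
Proof.
case: b => [//|b] lb _ [_ _ _ iH].
case: (iH (@etaH n m b.+1 l)); first exact: subspace_etaH.
- by apply: gen_stable_osp; exact: gen_stable_etaH.
- move=> f /etaHE[h Hh ->]; apply/HkE; rewrite (Lap_etan _ Hh); split.
    by have /HkE[Eh _] := Hh; rewrite (Eul_etan _ Eh) -natrD.
  rewrite (_ : _ + sdim n m = 0) ?mulr0 ?scale0r //; apply/eqP.
  by rewrite addrA -natrD subr_eq0 -natrD eqr_nat; lia.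
- move=> Z; apply: (@xpow_neq0 l); apply: (@etan_inj0 b.+1 _ _ (xpowP l)).
  apply/funext; apply: Z; apply/etaHE; exists (xpow l) => //.
  exact: xline_Hk (xpowP l).
- move=> /(_ _ (xline_Hk (xpowP _)))/etaHE[h _ e].
  by apply: (@xpow_neq0 (l + 2 * b.+1)); exact: xline_notin_Eta (xpowP _) e.
Qed.

Variable i1 : 'I_n.
Hypothesis i01 : i0 != i1.

(** * Irreducibility of H_k outside the excluded range *)

Section Regular.
Variable k : nat.
Hypothesis regular : forall d, (d.+2 <= k)%N -> k%:R + d%:R + 2 * (sdim n m - 1) != 0.

(** The singular vector of W lies on the line of x^k, which is one-dimensional. *)
Lemma xline_sub W f : subspace W -> gen_stable W -> (forall f, W f -> Hk k f) ->
  (exists2 g, W g & g <> 0) -> xline i0 k f -> W f.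
Proof.
move=> sW gW WH W0 xf.
have [|g [Wg g0 sg]] := @exists_singular n m i0 k W sW gW _ W0; first by move=> g /WH[].
have xg := singular_xline i01 (WH _ Wg) sg regular.
have [c ->] := xline_scale xg xf (exists_neq0 g0).
exact: subZ.
Qed.

Lemma Hk_Eta_eq0 g : Hk k (Eta g) -> Eta g = 0.
Proof.
move=> HEg; apply: contrapT => E0.
pose W f := Hk k f /\ exists g, f = Eta g.
have [] // := @xpow_neq0 k.
have [||f []//||_ [g' e]] := @xline_sub W (xpow k) _ _ _ _ (xpowP k).
- have sH := subspace_Hk n m k; split.
  + by split; [exact: (sub0 sH) | exists 0; exact/esym/linear0].
  + move=> f f' [Hf [h e]] [Hf' [h' e']].
    by split; [exact: (subD sH) | exists (h + h'); rewrite EtaD -e -e'].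
  + by move=> c f [Hf [h e]]; split; [exact: (subZ sH) | exists (c *: h); rewrite EtaZ -e].
- move=> u v f [Hf [h e]]; split; first exact: gen_stable_Hk.
  by exists (gen u v h); rewrite -Eta_gen -e.
- by exists (Eta g) => //; split=> //; exists g.
- exact: xline_notin_Eta (xpowP k) e.
Qed.

Lemma sub_Eta_Ak W f : subspace W -> gen_stable W -> (forall f, xline i0 k f -> W f) ->
  Ak k f -> exists w g, [/\ W w, f = w + Eta g & Eul g = (k%:R - 2) *: g].
Proof.
move=> sW gW xW; have sE := subspace_Eul n m (k%:R - 2).
apply: (generate_Ak i01 (N := fun f => exists w g, [/\ W w, f = w + Eta g & Eul g = (k%:R - 2) *: g])).
- split.
  + exists 0, 0; split; [exact: (sub0 sW)| |exact: (sub0 sE)].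
    by rewrite linear0 addr0.
  + move=> f1 f2 [w1 [g1 [W1 -> E1]]] [w2 [g2 [W2 -> E2]]].
    exists (w1 + w2), (g1 + g2); split; [exact: (subD sW)| |exact: (subD sE E1 E2)].
    by rewrite paddE EtaD addrACA.
  + move=> c f1 [w1 [g1 [W1 -> E1]]].
    exists (c *: w1), (c *: g1); split; [exact: (subZ sW)| |exact: (subZ sE _ E1)].
    by rewrite EtaZ -scalerDr.
- move=> u v f1 [w1 [g1 [W1 -> E1]]].
  exists (gen u v w1), (gen u v g1); split; [exact: gW| |].
    by rewrite linearD /= Eta_gen.
  exact: gen_stable_Eul.
- move=> f1 /xW W1; exists f1, 0; split=> //; last exact: (sub0 sE).
  by rewrite linear0 addr0.
- move=> g1 E1; exists 0, g1; split=> //; first exact: (sub0 sW).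
  by rewrite add0r.
- exact: regular.
Qed.

Lemma irreducible_Hk : irreducible (@Hk n m k).
Proof.
split; [exact: subspace_Hk| | |].
- by apply: gen_stable_osp; exact: gen_stable_Hk.
- exists (xpow k); split; last exact/exists_neq0/xpow_neq0.
  exact: xline_Hk (xpowP k).
move=> W sW /(osp_gen_stable sW) gW WH.
have [[f Wf f0]|W0] := pselect (exists2 f, W f & f <> 0); [right|left]; last first.
  move=> f Wf z; suff -> : f = 0 by [].
  by apply: contrapT => f0; apply: W0; exists f.
move=> h Hh; have [|w [g [Ww e Eg]]] := sub_Eta_Ak sW gW _ (proj1 Hh).
  by move=> f' /(xline_sub sW gW WH); apply; exists f.
(* [Eta g] is the difference of the harmonic elements h and w. *)
have E0 : Eta g = 0.
  apply: Hk_Eta_eq0; rewrite (_ : Eta g = h - w); last by rewrite e addrAC subrr add0r.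
  by apply: (subB (subspace_Hk n m _)) => //; exact: WH.
by rewrite e E0 addr0.
Qed.
End Regular.

(** Strong induction on A_k = H_k + eta A_{k-2}, which is [sub_Eta_Ak] for W = H_k; the bound on k
    passes to k - 2. *)
Lemma Ak_decomp k f : (k + n <= m.+1)%N -> Ak k f ->
  exists2 H : nat -> spoly n m,
    forall i, (i <= k./2)%N -> Hk (k - 2 * i) (H i) &
    f = \sum_(i < (k./2).+1) etan i (H i).
Proof.
elim/ltn_ind: k f => k IH f kn Af.
have [||||w [g [Hw -> Eg]]] := @sub_Eta_Ak k _ (@Hk n m k) f _ _ _ Af.
- by apply: regular_weights; left.
- exact: subspace_Hk.
- exact: gen_stable_Hk.
- by move=> f'; exact: xline_Hk.
case: (ltnP k 2) => k2.
  exists (fun=> w); first by case=> [|i]; rewrite ?subn0 //; lia.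
  by rewrite (Eul_neg k2 Eg) linear0 addr0 (_ : k./2 = 0%N) ?big_ord1 //; lia.
have [|||H HH ->] := IH (k - 2)%N _ g _ _; [lia|lia| |].
  by apply/AkE; rewrite natrB.
exists (fun i => if i is i'.+1 then H i' else w).
  case=> [|i] ik; first by rewrite subn0.
  by have := HH i; rewrite -subnDA -mulnS; apply; lia.
have -> : k./2 = (k - 2)./2.+1 by lia.
by rewrite [RHS]big_ord_recl linear_sum; congr (_ + _).
Qed.

End Irreducible.

(** * The criterion in natural numbers, then in integers, and the direct sum *)

Section Main.
Local Open Scope ring_scope.

Lemma irreducible_Hk_iff n m k : (1 < n)%N ->
  irreducible (@Hk n m k) <-> (k + n <= m.+1)%N \/ (2 * m.+1 < k + 2 * n)%N.
Proof.
move=> n1; pose i0 := Ordinal (ltnW n1); pose i1 := Ordinal n1.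
have i01 : i0 != i1 by [].
split=> [ir|H]; last by apply: (irreducible_Hk i01); exact: regular_weights.
apply: contrapT => /not_orP[/negP + /negP]; rewrite -!ltnNge => a b.
(* These b and l solve l + 2 b = k and l + b = m + 1 - n; in the excluded range b > 0 and l >= 0, so
   no subtraction truncates. *)
apply: (@reducible_Hk n m i0 (k + n - m.+1) (2 * m.+1 - 2 * n - k)); [lia|lia|].
by rewrite (_ : (_ + _)%N = k) //; lia.
Qed.

End Main.

Theorem theorem4p1 (n m : nat) (hn : (1 < n)%N) (k : nat) :
  (irreducible (@Hk n m k) <->
     ((Posz k <= Posz m + 1 - Posz n)%R \/ (2 * (Posz m + 1 - Posz n) < Posz k)%R)) /\
  ((Posz k <= Posz m + 1 - Posz n)%R ->
     (* each summand eta^i H_{k-2i} is an irreducible submodule *)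
     (forall i : nat, (i <= k./2)%N -> irreducible (@etaH n m i (k - 2 * i))) /\
     (* A_k is the sum of the summands *)
     (forall f : spoly n m, Ak k f <->
        exists h : 'I_(k./2).+1 -> spoly n m,
          (forall i : 'I_(k./2).+1, etaH i (k - 2 * i) (h i)) /\
          forall z, f z = (\sum_(i < (k./2).+1) h i z)%R) /\
     (* and the sum is direct *)
     (forall h : 'I_(k./2).+1 -> spoly n m,
        (forall i : 'I_(k./2).+1, etaH i (k - 2 * i) (h i)) ->
        (forall z, (\sum_(i < (k./2).+1) h i z)%R = 0%R) ->
        forall (i : 'I_(k./2).+1) z, h i z = 0%R)).
Proof.
pose i0 := Ordinal (ltnW hn); pose i1 := Ordinal hn.
have i01 : i0 != i1 by [].
split; first by rewrite irreducible_Hk_iff //; split=> -[H|H]; [left|right|left|right]; lia.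
move=> km; have kn : (k + n <= m.+1)%N by lia.
split; [|split].
- move=> i ik; apply: (irreducible_etaH i0); apply/irreducible_Hk_iff => //.
  by left; lia.
- move=> f; split=> [Af|[h [Hh fh]]].
    have [H HH ->] := Ak_decomp i01 kn Af.
    exists (fun i => etan i (H i)); split=> [i|z]; last by rewrite sumE.
    by apply/etaHE; exists (H i) => //; apply: HH; have := ltn_ord i; lia.
  have -> : f = (\sum_(i < (k./2).+1) h i)%R by apply/funext => z; rewrite fh sumE.
  apply/AkE; apply: (sub_sum (subspace_Eul n m _)) => i _; apply/AkE.
  by apply: etaH_Ak (Hh i); have := ltn_ord i; lia.
- move=> h Hh S0 i z.
  have HE (j : 'I_(k./2).+1) : exists g, Hk (k - 2 * j) g /\ h j = etan j g.
    by have /etaHE[g] := Hh j; exists g.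
  have [G HG] := choice HE.
  (* [etan_eq0] takes a family indexed by all naturals, so the chosen harmonic preimages are
     extended through [inord]. *)
  pose H j := G (inord j).
  have H0 : H i = 0%R.
    apply: (@etan_eq0 n m k (k./2).+1 H kn); [by lia| | |exact: ltn_ord].
      by move=> j jk; have [] := HG (inord j); rewrite inordK.
    apply/funext => z'; rewrite sumE -[RHS](S0 z'); apply: eq_bigr => j _.
    by rewrite /H inord_val; have [_ ->] := HG j.
  by have [_ ->] := HG i; move: H0; rewrite /H inord_val => ->; rewrite etan0.
Qed.
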